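(* If $G$ is a nonabelian group that is residually locally torsion-free nilpotent, then the action of $\mathrm{Comm}(G)$ on $\mathrm{VLO}(G)$ is faithful.
   Context: A left-invariant order on a group $G$ is a (strict) total order $\prec$ on $G$ such that $x \prec y \Rightarrow gx \prec gy$ for all $x,y,g \in G$; $\mathrm{LO}(G)$ is the set of all of them. A commensuration of $G$ is an isomorphism $\phi \colon G_1 \to G_2$, where $G_1$ and $G_2$ are finite-index subgroups of $G$. Two commensurations $\phi \colon G_1 \to G_2$ and $\phi' \colon G_1' \to G_2'$ are equivalent if there is a finite-index subgroup $H$ of $G_1 \cap G_1'$ such that $\phi$ and $\phi'$ have the same restriction to $H$. The equivalence classes of commensurations form a group $\mathrm{Comm}(G)$ (the abstract commensurator), with multiplication given by composition restricted to a finite-index subgroup where it is defined. $\mathrm{VLO}(G)$ denotes the direct limit $\varinjlim \mathrm{LO}(H)$ over all finite-index subgroups $H$ of $G$, with respect to the restriction maps $\mathrm{LO}(H_2) \to \mathrm{LO}(H_1)$ for $H_1 \subseteq H_2$; thus an element is represented by a left-invariant order on some finite-index subgroup, and two such orders represent the same element iff they agree on some common finite-index subgroup. $\mathrm{Comm}(G)$ acts on $\mathrm{VLO}(G)$: if $\alpha$ is represented by $\phi\colon G_1\to G_2$ and an element of $\mathrm{VLO}(G)$ is represented by $\prec$ on $H$, then ${\prec}^\alpha$ is represented by the order on $\phi(H \cap G_1)$ defined by $\phi(x) \prec^\alpha \phi(y) \iff x \prec y$ for $x,y \in H\cap G_1$. (Elements of $\mathrm{Comm}(G)$ are written as acting on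 the right.) A group $G$ is residually locally torsion-free nilpotent if for every $g \neq e$ in $G$ there is a normal subgroup $N$ of $G$ with $g \notin N$ such that $G/N$ is torsion-free and locally nilpotent (every finitely generated subgroup of $G/N$ is nilpotent). *)

(* Defs.v *)
From HB Require Import structures.
From mathcomp Require Import all_boot.
From mathcomp Require Import boolp classical_sets functions cardinality.

Set Implicit Arguments.
Unset Strict Implicit.
Unset Printing Implicit Defensive.

Local Open Scope classical_set_scope.
Local Open Scope group_scope.
Local Open Scope quotient_scope.

(* A [groupType] may be infinite. Its choice structure is no restriction, as  *)
(* [gen_choiceMixin] puts one on any type.                                    *)

Definition subgroup (G : groupType) (H : set G) : Prop :=
  [/\ H 1, forall x y, H x -> H y -> H (x * y) & forall x, H x -> H x^-1].

Definition lcoset (G : groupType) (H : set G) (g : G) : set G :=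
  [set g * h | h in H].

(* Meant for a subgroup [K]; being a subgroup is part of the condition on [H]. *)
Definition finite_index (G : groupType) (H K : set G) : Prop :=
  [/\ subgroup H, H `<=` K & finite_set [set lcoset H g | g in K]].

Definition generated (G : groupType) (A : set G) : set G :=
  smallest (@subgroup G) A.

Fixpoint lower_central (G : groupType) (H : set G) (n : nat) : set G :=
  if n is n'.+1 then
    generated [set [~ x, y] | x in lower_central H n' & y in H]
  else H.

Definition nilpotent (G : groupType) (H : set G) : Prop :=
  exists n, lower_central H n = [set 1].

Definition locally_nilpotent (G : groupType) : Prop :=
  forall A : set G, finite_set A -> nilpotent (generated A).

Definition torsion_free (G : groupType) : Prop :=
  forall (x : G) n, (0 < n)%N -> x ^+ n = 1 -> x = 1.

Definition nonabelian (G : groupType) : Prop :=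
  ~ forall x y : G, commute x y.

Section Subgroups.
Variable G : groupType.
Implicit Types (H K L : set G) (x y z g : G).

Lemma subgroupI H K : subgroup H -> subgroup K -> subgroup (H `&` K).
Proof.
move=> [H1 HM HV] [K1 KM KV]; split=> [//|x y [? ?] [? ?]|x [? ?]].
  by split; [exact: HM | exact: KM].
by split; [exact: HV | exact: KV].
Qed.

Lemma subgroupT : subgroup [set: G].
Proof. by []. Qed.

Lemma finite_indexP H K : subgroup H -> subgroup K -> H `<=` K ->
  finite_index H K <-> exists s : seq G,
    forall g, K g -> exists t, [/\ t \in s, K t & H (t^-1 * g)].
Proof.
move=> sH sK sHK; have [H1 HM HV] := sH; split=> [[_ _]|[s Hs]].
  move=> /finite_seqP[s Es].
  exists [seq xget 1 [set g | K g /\ C = lcoset H g] | C <- s] => g Kg.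
  exists (xget 1 [set g' | K g' /\ lcoset H g = lcoset H g']).
  have [Kt Et] : [set g' | K g' /\ lcoset H g = lcoset H g']
      (xget 1 [set g' | K g' /\ lcoset H g = lcoset H g']).
    by apply: xgetPex; exists g.
  split=> //; first apply/mapP.
    exists (lcoset H g) => //.
    have : [set` s] (lcoset H g) by rewrite -Es; exists g.
    by [].
  have [h Hh Eh] : lcoset H (xget 1 [set g' | K g' /\ lcoset H g = lcoset H g']) g.
    by rewrite -Et; exists 1 => //; rewrite mulg1.
  by rewrite -[X in _ * X]Eh mulKg.
split=> //; apply: (@sub_finite_set _ _ [set lcoset H g | g in [set` s]]).
  move=> C [g Kg <-]; have [t [ts Kt Htg]] := Hs g Kg.
  exists t => //; apply/seteqP; split=> x [h Hh <-].
    exists (g^-1 * (t * h)); last by rewrite mulVKg.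
    rewrite mulgA; apply: HM => //.
    by rewrite -[t]invgK -invgM; apply: HV.
  exists (t^-1 * (g * h)); last by rewrite mulVKg.
  by rewrite mulgA; apply: HM.
by apply: finite_image; apply/finite_seqP; exists s.
Qed.

Lemma finite_indexTP H : finite_index H setT <->
  subgroup H /\ exists s : seq G, forall g, exists2 t, t \in s & H (t^-1 * g).
Proof.
split=> [fi|[sH [s Hs]]].
  have [sH HT _] := fi; split=> //.
  have /(finite_indexP sH subgroupT HT)[s Hs] := fi.
  by exists s => g; have [t [ts _ Ht]] := Hs g I; exists t.
apply/(finite_indexP sH subgroupT (@subsetT _ _)); exists s => g _.
by have [t ts Ht] := Hs g; exists t.
Qed.

Lemma finite_indexTT : finite_index [set: G] setT.
Proof.
by apply/finite_indexTP; split=> //; exists [:: 1] => g; exists 1; rewrite ?inE.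
Qed.

Lemma finite_index_subgroup H K : finite_index H K -> subgroup H.
Proof. by case. Qed.

Lemma finite_indexI H K :
  finite_index H setT -> finite_index K setT -> finite_index (H `&` K) setT.
Proof.
move=> /finite_indexTP[sH [s Hs]] /finite_indexTP[sK [r Kr]].
have [H1 HM HV] := sH; have [K1 KM KV] := sK.
apply/finite_indexTP; split; first exact: subgroupI.
pose z t u := xget 1 [set z | H (t^-1 * z) /\ K (u^-1 * z)].
exists [seq z t u | t <- s, u <- r] => g.
have [t ts Ht] := Hs g; have [u ur Ku] := Kr g.
exists (z t u); first by apply/allpairsP; exists (t, u).
have [Hz Kz] : [set z | H (t^-1 * z) /\ K (u^-1 * z)] (z t u).
  by apply: xgetPex; exists g.
split.
  have -> : (z t u)^-1 * g = (t^-1 * z t u)^-1 * (t^-1 * g).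
    by rewrite invgM invgK -mulgA mulVKg.
  by apply: HM => //; apply: HV.
have -> : (z t u)^-1 * g = (u^-1 * z t u)^-1 * (u^-1 * g).
  by rewrite invgM invgK -mulgA mulVKg.
by apply: KM => //; apply: KV.
Qed.

Lemma finite_index_trans H K L :
  subgroup K -> subgroup L -> finite_index H K -> finite_index K L ->
  finite_index H L.
Proof.
move=> sK sL fH fK; have [sH HK _] := fH; have [_ KL _] := fK.
have HL := subset_trans HK KL; have [_ LM _] := sL.
apply/(finite_indexP sH sL HL).
have /(finite_indexP sH sK HK)[s Hs] := fH.
have /(finite_indexP sK sL KL)[r Kr] := fK.
exists [seq u * t | u <- r, t <- s] => g Lg.
have [u [ur Lu Ku]] := Kr g Lg; have [t [ts Kt Ht]] := Hs _ Ku.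
exists (u * t); split; first by apply/allpairsP; exists (u, t).
  by apply: LM => //; exact: KL.
by rewrite invgM -mulgA.
Qed.

Lemma finite_index_sub H K L : subgroup K -> subgroup L ->
  H `<=` K -> K `<=` L -> finite_index H L -> finite_index H K.
Proof.
move=> sK sL HK KL [sH HL fH]; split=> //.
by apply: sub_finite_set fH => C [g /KL Lg <-]; exists g.
Qed.

Lemma finite_index_sup H K L : subgroup K -> subgroup L ->
  H `<=` K -> K `<=` L -> finite_index H L -> finite_index K L.
Proof.
move=> sK sL HK KL fH; have [sH HL _] := fH.
have /(finite_indexP sH sL HL)[s Hs] := fH.
apply/(finite_indexP sK sL KL); exists s => g Lg.
by have [t [ts Lt /HK Kt]] := Hs g Lg; exists t.
Qed.

End Subgroups.

Record normal_subgroup (G : groupType) := NormalSubgroup {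
  normal_set : set G;
  normal_subgroupP : subgroup normal_set;
  normalJ : forall x g, normal_set x -> normal_set (x ^ g)
}.

Section Quotient.
Variables (G : groupType) (N : normal_subgroup G).
Implicit Types x y z : G.

Definition coset_rel : rel G := fun x y => `[< normal_set N (x^-1 * y) >].

Lemma coset_rel_equiv : equiv_class_of coset_rel.
Proof.
have [N1 NM NV] := normal_subgroupP N; split=> [x|x y|y x z].
- by apply/asboolP; rewrite mulVg.
- by apply/asboolP/asboolP => /NV; rewrite invgM invgK.
- move=> /asboolP Nxy /asboolP Nyz; apply/asboolP.
  by have := NM _ _ Nxy Nyz; rewrite -mulgA mulVKg.
Qed.

Canonical coset_equiv := EquivRelPack coset_rel_equiv.

Definition quotient_group := {eq_quot coset_equiv}.
HB.instance Definition _ := Choice.on quotient_group.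

Definition coset_class (x : G) : quotient_group := \pi_{eq_quot coset_equiv} x.

Lemma coset_eqP x y :
  reflect (coset_class x = coset_class y) `[< normal_set N (x^-1 * y) >].
Proof. exact: (@eqmodP _ coset_equiv x y). Qed.

Lemma coset_class_surj (a : quotient_group) : exists x, coset_class x = a.
Proof. by exists (repr a); exact: reprK. Qed.

Definition coset_one : quotient_group := coset_class 1.
Definition coset_inv (a : quotient_group) : quotient_group :=
  coset_class (repr a)^-1.
Definition coset_mul (a b : quotient_group) : quotient_group :=
  coset_class (repr a * repr b).

Lemma coset_reprK x : coset_class (repr (coset_class x)) = coset_class x.
Proof. exact: reprK. Qed.

Lemma coset_invE x : coset_inv (coset_class x) = coset_class x^-1.
Proof.
have [N1 NM NV] := normal_subgroupP N.
apply/coset_eqP/asboolP; rewrite invgK.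
have /coset_eqP/asboolP/NV := coset_reprK x.
set r := repr _; rewrite invgM invgK => /(normalJ x^-1).
by rewrite /conjg invgK mulgA mulVKg.
Qed.

Lemma coset_mulE x y :
  coset_mul (coset_class x) (coset_class y) = coset_class (x * y).
Proof.
have [N1 NM NV] := normal_subgroupP N.
apply/coset_eqP/asboolP.
have /coset_eqP/asboolP := coset_reprK x.
have /coset_eqP/asboolP := coset_reprK y.
set r := repr _; set s := repr _ => Ny /(normalJ y) Nx.
have := NM _ _ Ny Nx.
by rewrite /conjg !mulgA mulgK invgM -!mulgA.
Qed.

Lemma coset_mulA : associative coset_mul.
Proof.
move=> a b c; have [x <-] := coset_class_surj a.
have [y <-] := coset_class_surj b; have [z <-] := coset_class_surj c.
by rewrite !coset_mulE mulgA.
Qed.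
Lemma coset_mul1 : left_id coset_one coset_mul.
Proof. by move=> a; have [x <-] := coset_class_surj a; rewrite coset_mulE mul1g. Qed.
Lemma coset_mulr1 : right_id coset_one coset_mul.
Proof. by move=> a; have [x <-] := coset_class_surj a; rewrite coset_mulE mulg1. Qed.
Lemma coset_mulV : left_inverse coset_one coset_inv coset_mul.
Proof. by move=> a; have [x <-] := coset_class_surj a; rewrite coset_invE coset_mulE mulVg. Qed.
Lemma coset_mulrV : right_inverse coset_one coset_inv coset_mul.
Proof. by move=> a; have [x <-] := coset_class_surj a; rewrite coset_invE coset_mulE mulgV. Qed.

HB.instance Definition _ := isGroup.Build quotient_group
  coset_mulA coset_mul1 coset_mulr1 coset_mulV coset_mulrV.

End Quotient.

Definition residually_locally_tf_nilpotent (G : groupType) : Prop :=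
  forall g : G, g != 1 -> exists N : normal_subgroup G,
    [/\ ~ normal_set N g, torsion_free (quotient_group N)
      & locally_nilpotent (quotient_group N)].

(* An isomorphism between two finite-index subgroups. The values of [cmap]    *)
(* outside [cdom] are junk, which the equivalence [comm_agree] ignores.       *)
Record commensuration (G : groupType) := Commensuration {
  cdom : set G;
  ccod : set G;
  cmap :> G -> G;
  cdom_fi : finite_index cdom setT;
  ccod_fi : finite_index ccod setT;
  cmap_bij : set_bij cdom ccod cmap;
  cmapM : forall x y, cdom x -> cdom y -> cmap (x * y) = cmap x * cmap y
}.

HB.instance Definition _ (G : groupType) := gen_eqMixin (commensuration G).
HB.instance Definition _ (G : groupType) := gen_choiceMixin (commensuration G).

Definition comm_agree (G : groupType) (f f' : commensuration G) : Prop :=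
  exists2 K, finite_index K (cdom f `&` cdom f') & forall x, K x -> f x = f' x.

Section Commensurator.
Variable G : groupType.
Implicit Types (f g h : commensuration G) (H K L : set G).

Lemma comm_agreeP f g : comm_agree f g <-> exists K,
  [/\ finite_index K setT, K `<=` cdom f, K `<=` cdom g
    & forall x, K x -> f x = g x].
Proof.
have fD := cdom_fi f; have gD := cdom_fi g.
have fiI := finite_indexI fD gD; have sI := finite_index_subgroup fiI.
split=> [[K fK E]|[K [fK Kf Kg E]]].
  exists K; split=> //; last 2 first.
  - by case: fK => _ KI _ x /KI[].
  - by case: fK => _ KI _ x /KI[].
  by apply: finite_index_trans fK fiI.
exists K => //; apply: finite_index_sub fK => //.
by move=> x Kx; split; [exact: Kf | exact: Kg].
Qed.

Lemma cmap1 f : f 1 = 1.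
Proof.
have [D1 _ _] := finite_index_subgroup (cdom_fi f).
by apply: (@mulgI _ (f 1)); rewrite -cmapM // !mulg1.
Qed.

Lemma cmapV f x : cdom f x -> f x^-1 = (f x)^-1.
Proof.
move=> Dx; have [_ _ DV] := finite_index_subgroup (cdom_fi f).
by apply: (@mulgI _ (f x)); rewrite -cmapM ?mulgV ?cmap1 //; apply: DV.
Qed.

Lemma cmap_cod f x : cdom f x -> ccod f (f x).
Proof. by have [F _ _] := cmap_bij f; move=> Dx; apply: F. Qed.

Lemma cmap_inj f x y : cdom f x -> cdom f y -> f x = f y -> x = y.
Proof. by have [_ F _] := cmap_bij f; move=> Dx Dy; apply: F; rewrite inE. Qed.

Lemma cmap_surj f y : ccod f y -> exists2 x, cdom f x & f x = y.
Proof. by have [_ _ F] := cmap_bij f; move=> /F[x]; exists x. Qed.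

Lemma finite_index_preim f L : finite_index L setT ->
  finite_index (cdom f `&` f @^-1` L) setT.
Proof.
move=> /finite_indexTP[sL [s Ls]]; have [L1 LM LV] := sL.
have fD := cdom_fi f; have sD := finite_index_subgroup fD.
have [D1 DM DV] := sD.
have sP : subgroup (cdom f `&` f @^-1` L).
  split=> [|x y [Dx Lx] [Dy Ly]|x [Dx Lx]].
  - by split=> //=; rewrite cmap1.
  - by split; [exact: DM | rewrite /= cmapM //; exact: LM].
  - by split; [exact: DV | rewrite /= cmapV //; exact: LV].
apply: (@finite_index_trans _ _ (cdom f)) => //.
apply/(finite_indexP sP sD); first by move=> x [].
pose z t := xget 1 [set x | cdom f x /\ L (t^-1 * f x)].
exists [seq z t | t <- s] => x Dx; have [t ts Lt] := Ls (f x).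
have [Dz Lz] : [set x | cdom f x /\ L (t^-1 * f x)] (z t).
  by apply: xgetPex; exists x.
exists (z t); split=> //; first by apply/mapP; exists t.
split; first by apply: DM => //; exact: DV.
rewrite /= cmapM // ?cmapV //; last exact: DV.
have -> : (f (z t))^-1 * f x = (t^-1 * f (z t))^-1 * (t^-1 * f x).
  by rewrite invgM invgK -mulgA mulVKg.
by apply: LM => //; exact: LV.
Qed.

Lemma finite_index_img f L : finite_index L setT -> L `<=` cdom f ->
  finite_index (f @` L) setT.
Proof.
move=> fL LD; have sL := finite_index_subgroup fL; have [L1 LM LV] := sL.
have sD := finite_index_subgroup (cdom_fi f).
have fC := ccod_fi f; have sC := finite_index_subgroup fC.
have sI : subgroup (f @` L).
  split=> [|_ _ [x Lx <-] [y Ly <-]|_ [x Lx <-]].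
  - by exists 1 => //; exact: cmap1.
  - by exists (x * y); [exact: LM | rewrite cmapM //; exact: LD].
  - by exists x^-1; [exact: LV | rewrite cmapV //; exact: LD].
have fLD : finite_index L (cdom f) by apply: finite_index_sub fL.
apply: (@finite_index_trans _ _ (ccod f)) => //.
have IC : f @` L `<=` ccod f by move=> _ [x /LD Dx <-]; exact: cmap_cod.
have /(finite_indexP sL sD LD)[s Hs] := fLD.
apply/(finite_indexP sI sC IC); exists [seq f t | t <- s] => y Cy.
have [x Dx <-] := cmap_surj Cy; have [t [ts Dt Lt]] := Hs x Dx.
exists (f t); split; [exact: map_f | exact: cmap_cod |].
have [_ _ DV] := sD.
by exists (t^-1 * x) => //; rewrite cmapM ?cmapV //; exact: DV.
Qed.

Lemma comm_agree_equiv :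
  equiv_class_of (fun f g => `[< comm_agree f g >]).
Proof.
split=> [f|f g|g f h].
- apply/asboolP/comm_agreeP; exists (cdom f); split=> //; exact: cdom_fi.
- by apply/asboolP/asboolP => /comm_agreeP[K [fK Kf Kg E]];
    apply/comm_agreeP; exists K; split=> // x Kx; rewrite E.
- move=> /asboolP/comm_agreeP[K [fK Kf Kg E]].
  move=> /asboolP/comm_agreeP[L [fL Lg Lh F]].
  apply/asboolP/comm_agreeP; exists (K `&` L); split.
  + exact: finite_indexI.
  + by move=> x [/Kf].
  + by move=> x [_ /Lh].
  + by move=> x [Kx Lx]; rewrite E ?F.
Qed.

Canonical comm_equiv := EquivRelPack comm_agree_equiv.

Definition Comm := {eq_quot comm_equiv}.
HB.instance Definition _ := Choice.on Comm.

Definition comm_class (f : commensuration G) : Comm := \pi_{eq_quot comm_equiv} f.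

Lemma comm_classP f g : comm_class f = comm_class g <-> comm_agree f g.
Proof.
split=> [/(@eqmodP _ comm_equiv f g)/asboolP //|E].
by apply/(@eqmodP _ comm_equiv f g)/asboolP.
Qed.

Lemma comm_class_surj (a : Comm) : exists f, comm_class f = a.
Proof. by exists (repr a); exact: reprK. Qed.

Lemma comm_id_bij : set_bij [set: G] setT id.
Proof. by split=> // x _; exists x. Qed.

Definition comm_id : commensuration G :=
  @Commensuration G setT setT id (@finite_indexTT G) (@finite_indexTT G)
    comm_id_bij (fun _ _ _ _ => erefl).

Definition comp_dom f g : set G := cdom f `&` f @^-1` cdom g.
Definition comp_cod f g : set G := (g \o f) @` comp_dom f g.

Lemma comp_dom_fi f g : finite_index (comp_dom f g) setT.
Proof. exact/finite_index_preim/cdom_fi. Qed.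

Lemma comp_cod_fi f g : finite_index (comp_cod f g) setT.
Proof.
rewrite /comp_cod -image_comp; apply: finite_index_img.
  by apply: finite_index_img; [exact: comp_dom_fi | move=> x []].
by move=> _ [x [_ Dx] <-].
Qed.

Lemma comp_bij f g : set_bij (comp_dom f g) (comp_cod f g) (g \o f).
Proof.
split=> [x Dx|x y|y [x Dx <-]]; [by exists x| |by exists x].
rewrite !inE => -[Dx Dfx] [Dy Dfy] /= E.
by apply: cmap_inj (Dx) (Dy) _; apply: cmap_inj (Dfx) (Dfy) _.
Qed.

Lemma comp_morph f g x y : comp_dom f g x -> comp_dom f g y ->
  (g \o f) (x * y) = (g \o f) x * (g \o f) y.
Proof. by move=> [Dx Dfx] [Dy Dfy]; rewrite /= !cmapM. Qed.

(* First [f], then [g]: commensurations act on the right. *)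
Definition comm_comp f g : commensuration G :=
  Commensuration (comp_dom_fi f g) (comp_cod_fi f g) (@comp_bij f g)
    (@comp_morph f g).

Definition inv_map f (y : G) : G := xget 1 [set x | cdom f x /\ f x = y].

Lemma inv_mapP f y : ccod f y -> cdom f (inv_map f y) /\ f (inv_map f y) = y.
Proof.
move=> Cy; suff: [set x | cdom f x /\ f x = y] (inv_map f y) by [].
by apply: xgetPex; have [x Dx E] := cmap_surj Cy; exists x.
Qed.

Lemma inv_mapK f x : cdom f x -> inv_map f (f x) = x.
Proof.
by move=> Dx; have [D E] := inv_mapP (cmap_cod Dx); apply: cmap_inj D Dx E.
Qed.

Lemma inv_bij f : set_bij (ccod f) (cdom f) (inv_map f).
Proof.
split=> [y /inv_mapP[]//|y z|x Dx].
  by rewrite !inE => /inv_mapP[_ Ey] /inv_mapP[_ Ez] E; rewrite -Ey E.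
by exists (f x); [exact: cmap_cod | exact: inv_mapK].
Qed.

Lemma inv_morph f x y : ccod f x -> ccod f y ->
  inv_map f (x * y) = inv_map f x * inv_map f y.
Proof.
move=> /inv_mapP[Dx Ex] /inv_mapP[Dy Ey]; rewrite -{1}Ex -{1}Ey -cmapM //.
apply: inv_mapK.
by have [_ DM _] := finite_index_subgroup (cdom_fi f); apply: DM.
Qed.

Definition comm_inv f : commensuration G :=
  Commensuration (ccod_fi f) (cdom_fi f) (inv_bij f) (@inv_morph f).

Lemma comm_comp_agree f f' g g' :
  comm_agree f f' -> comm_agree g g' ->
  comm_agree (comm_comp f g) (comm_comp f' g').
Proof.
move=> /comm_agreeP[K [fK Kf Kf' E]] /comm_agreeP[L [fL Lg Lg' F]].
apply/comm_agreeP; exists (K `&` (cdom f `&` f @^-1` L)); split.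
- by apply: finite_indexI => //; exact: finite_index_preim.
- by move=> x [_ [Dx /Lg]].
- move=> x [Kx [Dx Lx]]; split; first exact: Kf'.
  by rewrite /= -E //; exact: Lg'.
- by move=> x [Kx [Dx Lx]] /=; rewrite -E //; apply: F.
Qed.

Lemma comm_inv_agree f f' :
  comm_agree f f' -> comm_agree (comm_inv f) (comm_inv f').
Proof.
move=> /comm_agreeP[K [fK Kf Kf' E]]; apply/comm_agreeP; exists (f @` K); split.
- exact: finite_index_img.
- by move=> _ [x /Kf Dx <-]; exact: cmap_cod.
- by move=> _ [x Kx <-]; rewrite E //; exact/cmap_cod/Kf'.
- move=> _ [x Kx <-] /=; rewrite inv_mapK; last exact: Kf.
  by rewrite E // inv_mapK //; exact: Kf'.
Qed.

Definition Comm_one : Comm := comm_class comm_id.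
Definition Comm_inv (a : Comm) : Comm := comm_class (comm_inv (repr a)).
Definition Comm_mul (a b : Comm) : Comm :=
  comm_class (comm_comp (repr a) (repr b)).

Lemma repr_comm_class f : comm_agree (repr (comm_class f)) f.
Proof. by apply/comm_classP; exact: reprK. Qed.

Lemma Comm_invE f : Comm_inv (comm_class f) = comm_class (comm_inv f).
Proof. exact/comm_classP/comm_inv_agree/repr_comm_class. Qed.

Lemma Comm_mulE f g :
  Comm_mul (comm_class f) (comm_class g) = comm_class (comm_comp f g).
Proof.
by apply/comm_classP/comm_comp_agree; exact: repr_comm_class.
Qed.

Lemma Comm_mulA : associative Comm_mul.
Proof.
move=> a b c; have [f <-] := comm_class_surj a.
have [g <-] := comm_class_surj b; have [h <-] := comm_class_surj c.
rewrite !Comm_mulE; apply/comm_classP/comm_agreeP.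
exists (cdom (comm_comp f (comm_comp g h))); split=> //; first exact: cdom_fi.
by move=> x [Df [Dg Dh]].
Qed.

Lemma Comm_mul1 : left_id Comm_one Comm_mul.
Proof.
move=> a; have [f <-] := comm_class_surj a.
rewrite Comm_mulE; apply/comm_classP/comm_agreeP.
by exists (cdom f); split=> //; exact: cdom_fi.
Qed.

Lemma Comm_mulr1 : right_id Comm_one Comm_mul.
Proof.
move=> a; have [f <-] := comm_class_surj a.
rewrite Comm_mulE; apply/comm_classP/comm_agreeP.
by exists (cdom f); split=> //; exact: cdom_fi.
Qed.

Lemma Comm_mulV : left_inverse Comm_one Comm_inv Comm_mul.
Proof.
move=> a; have [f <-] := comm_class_surj a.
rewrite Comm_invE Comm_mulE; apply/comm_classP/comm_agreeP.
exists (ccod f); split=> //; first exact: ccod_fi.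
  by move=> y Cy; split=> //=; case: (inv_mapP Cy).
by move=> y /inv_mapP[].
Qed.

Lemma Comm_mulrV : right_inverse Comm_one Comm_inv Comm_mul.
Proof.
move=> a; have [f <-] := comm_class_surj a.
rewrite Comm_invE Comm_mulE; apply/comm_classP/comm_agreeP.
exists (cdom f); split=> //; first exact: cdom_fi.
  by move=> x Dx; split=> //=; exact: cmap_cod.
by move=> x /inv_mapK.
Qed.

HB.instance Definition _ := isGroup.Build Comm
  Comm_mulA Comm_mul1 Comm_mulr1 Comm_mulV Comm_mulrV.

End Commensurator.

Record left_order (G : groupType) (H : set G) (lt : G -> G -> Prop) : Prop :=
  LeftOrder {
    lo_irr : forall x, H x -> ~ lt x x;
    lo_trans : forall x y z, H x -> H y -> H z -> lt x y -> lt y z -> lt x z;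
    lo_total : forall x y, H x -> H y -> x <> y -> lt x y \/ lt y x;
    lo_mul : forall g x y, H g -> H x -> H y -> lt x y -> lt (g * x) (g * y)
  }.

(* An element of LO(H) for some finite-index subgroup H. The values of        *)
(* [vrel] outside [vdom] are junk, which the equivalence [vlo_agree] ignores. *)
Record virtual_order (G : groupType) := VirtualOrder {
  vdom : set G;
  vrel : G -> G -> Prop;
  vdom_fi : finite_index vdom setT;
  vrel_lo : left_order vdom vrel
}.

HB.instance Definition _ (G : groupType) := gen_eqMixin (virtual_order G).
HB.instance Definition _ (G : groupType) := gen_choiceMixin (virtual_order G).

Definition vlo_agree (G : groupType) (u v : virtual_order G) : Prop :=
  exists K, [/\ finite_index K setT, K `<=` vdom u `&` vdom v
    & forall x y, K x -> K y -> vrel u x y <-> vrel v x y].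

Section VLO.
Variable G : groupType.
Implicit Types (f g : commensuration G) (u v w : virtual_order G).

Lemma vlo_agree_equiv : equiv_class_of (fun u v => `[< vlo_agree u v >]).
Proof.
split=> [u|u v|v u w].
- by apply/asboolP; exists (vdom u); split=> //; exact: vdom_fi.
- by apply/asboolP/asboolP => -[K [fK KI E]]; exists K; split=> // [x /KI[]//|x y Kx Ky];
    rewrite E.
- move=> /asboolP[K [fK Kuv E]] /asboolP[L [fL Lvw F]].
  apply/asboolP; exists (K `&` L); split; first exact: finite_indexI.
    by move=> x [/Kuv[? _] /Lvw[_ ?]].
  by move=> x y [Kx Lx] [Ky Ly]; rewrite E // F.
Qed.

Canonical vlo_equiv := EquivRelPack vlo_agree_equiv.

Definition VLO := {eq_quot vlo_equiv}.
HB.instance Definition _ := Choice.on VLO.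

Definition vlo_class (u : virtual_order G) : VLO := \pi_{eq_quot vlo_equiv} u.

Lemma vlo_classP u v : vlo_class u = vlo_class v <-> vlo_agree u v.
Proof.
split=> [/(@eqmodP _ vlo_equiv u v)/asboolP //|E].
by apply/(@eqmodP _ vlo_equiv u v)/asboolP.
Qed.

Lemma vlo_class_surj (a : VLO) : exists u, vlo_class u = a.
Proof. by exists (repr a); exact: reprK. Qed.

Definition push_dom u f : set G := f @` (vdom u `&` cdom f).

Definition push_rel u f (a b : G) : Prop := exists x y,
  [/\ (vdom u `&` cdom f) x, (vdom u `&` cdom f) y, f x = a, f y = b
    & vrel u x y].

Lemma push_dom_fi u f : finite_index (push_dom u f) setT.
Proof.
apply: finite_index_img; last by move=> x [].
exact: finite_indexI (vdom_fi u) (cdom_fi f).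
Qed.

Lemma push_relE u f x y : (vdom u `&` cdom f) x -> (vdom u `&` cdom f) y ->
  push_rel u f (f x) (f y) <-> vrel u x y.
Proof.
move=> Dx Dy; split=> [[x' [y' [[_ Dx'] [_ Dy'] Ex Ey]]]|]; last by exists x, y.
by rewrite (cmap_inj Dx' Dx.2 Ex) (cmap_inj Dy' Dy.2 Ey).
Qed.

Lemma push_lo u f : left_order (push_dom u f) (push_rel u f).
Proof.
have [irr tr tot lm] := vrel_lo u.
have sI := subgroupI (finite_index_subgroup (vdom_fi u))
                     (finite_index_subgroup (cdom_fi f)).
have [_ IM _] := sI.
split.
- by move=> _ [x Dx <-]; rewrite push_relE //; apply: irr; exact: Dx.1.
- move=> _ _ _ [x Dx <-] [y Dy <-] [z Dz <-]; rewrite !push_relE //.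
  by apply: tr; [exact: Dx.1 | exact: Dy.1 | exact: Dz.1].
- move=> _ _ [x Dx <-] [y Dy <-] ne; rewrite !push_relE //.
  by apply: tot; [exact: Dx.1 | exact: Dy.1 | move=> E; apply: ne; rewrite E].
- move=> _ _ _ [g Dg <-] [x Dx <-] [y Dy <-].
  rewrite -!cmapM; [|exact: Dg.2|exact: Dy.2|exact: Dg.2|exact: Dx.2].
  rewrite !push_relE //; [|exact: IM..].
  by apply: lm; [exact: Dg.1 | exact: Dx.1 | exact: Dy.1].
Qed.

Definition push u f : virtual_order G :=
  VirtualOrder (push_dom_fi u f) (push_lo u f).

Lemma push_agree u u' f f' : vlo_agree u u' -> comm_agree f f' ->
  vlo_agree (push u f) (push u' f').
Proof.
move=> [L [fL LI F]] /comm_agreeP[K [fK Kf Kf' E]].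
have D x : (K `&` L) x -> (vdom u `&` cdom f) x.
  by move=> [Kx Lx]; split; [exact: (LI _ Lx).1 | exact: Kf].
have D' x : (K `&` L) x -> (vdom u' `&` cdom f') x.
  by move=> [Kx Lx]; split; [exact: (LI _ Lx).2 | exact: Kf'].
exists (f @` (K `&` L)); split.
- by apply: finite_index_img; [exact: finite_indexI | move=> x [/Kf]].
- move=> _ [x I <-]; split; first by exists x => //; exact: D.
  by rewrite (E x I.1); exists x => //; exact: D'.
- move=> _ _ [x Ix <-] [y Iy <-] /=.
  rewrite (push_relE (D _ Ix) (D _ Iy)) (F _ _ Ix.2 Iy.2).
  by rewrite (E x Ix.1) (E y Iy.1) (push_relE (D' _ Ix) (D' _ Iy)).
Qed.

Definition vlo_act (p : VLO) (a : Comm G) : VLO :=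
  vlo_class (push (repr p) (repr a)).

Lemma vlo_actE u f : vlo_act (vlo_class u) (comm_class f) = vlo_class (push u f).
Proof.
apply/vlo_classP/push_agree; last exact: repr_comm_class.
by apply/vlo_classP; exact: reprK.
Qed.

Lemma vlo_act1 p : vlo_act p 1 = p.
Proof.
have [u <-] := vlo_class_surj p; rewrite vlo_actE; apply/vlo_classP.
exists (vdom u); split; [exact: vdom_fi | | ].
  by move=> x Dx; split=> //; exists x.
by move=> x y Dx Dy; exact: (@push_relE u (comm_id G) x y (conj Dx I) (conj Dy I)).
Qed.

Lemma vlo_actM p (a b : Comm G) : vlo_act p (a * b) = vlo_act (vlo_act p a) b.
Proof.
have [u <-] := vlo_class_surj p; have [f <-] := comm_class_surj a.
have [g <-] := comm_class_surj b.
rewrite -[_ * _]/(Comm_mul _ _) Comm_mulE !vlo_actE; apply/vlo_classP.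
have D : vdom u `&` cdom (comm_comp f g) `<=` vdom u `&` cdom f.
  by move=> x [? []].
have D' x : (vdom u `&` cdom (comm_comp f g)) x ->
    (vdom (push u f) `&` cdom g) (f x).
  by move=> Dx; split; [exists x => //; exact: D | exact: Dx.2.2].
exists (push_dom u (comm_comp f g)); split; first exact: push_dom_fi.
  move=> _ [x Dx <-]; split; first by exists x.
  by exists (f x) => //; exact: D'.
move=> _ _ [x Dx <-] [y Dy <-] /=.
rewrite (push_relE Dx Dy) (push_relE (D' _ Dx) (D' _ Dy)).
by rewrite /= (push_relE (D _ Dx) (D _ Dy)).
Qed.

End VLO.

Definition faithful_action (A : groupType) (X : Type) (act : X -> A -> X) : Prop :=
  forall a : A, (forall x, act x a = x) -> a = 1.

(* Main.v *)
Require Import Defs.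
From HB Require Import structures.
From mathcomp Require Import all_boot all_order all_algebra.
From mathcomp Require Import boolp classical_sets cardinality filter.
From mathcomp Require Import zify ring lra.

Set Implicit Arguments.
Unset Strict Implicit.
Unset Printing Implicit Defensive.

Local Open Scope classical_set_scope.
Local Open Scope group_scope.

(** Let [f : D -> G] represent a commensuration that acts trivially on virtual
orders.  The proof has two halves.

First, every [x] in [D] has positive [m], [n] with [f x ^+ m = x ^+ n].  Suppose
not, so that no positive power of [x] is a positive power of [f x].  Then [G]
has a left order with [x] positive and [f x] negative
([left_order_prescribed]), and since some power of [f x] lies in any given
finite-index subgroup, [f] moves the class of this order
([trivial_action_comparable]).  By compactness such an order exists as soon as
signs can be chosen on each finite set of elements, compatibly with the two
prescribed ones.  Signs are chosen as in the Burns-Hale theorem: a nonzero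
homomorphism from the finitely generated subgroup to the rationals fixes the
signs of the elements outside its kernel, and there are fewer elements left
([finite_signs_prescribed]).  This requires enough homomorphisms: a finitely
generated nonabelian subgroup has two that are linearly independent
([fg_rank2]), because it has a nonabelian torsion-free nilpotent quotient, and
if [k + 1] is the least index at which the upper central series of that quotient
reaches the top, then its quotient by the [k]-th term is abelian of rank at
least two.

Second, let [r x = n / m] be the ratio such that [f x] behaves as the
[r x]-th power of [x].  If [x] and [y] have no common power, two homomorphisms
dual to [x] and [y], evaluated at [f (x * y) = f x * f y], give
[r x = r (x * y) = r y] ([ratio_eq]).  In a nonabelian torsion-free nilpotent
quotient there are [a] and [b] whose commutator is nontrivial and central, and
bilinearity gives [r [~ a, b] = r a * r b].  All three ratios are equal, hence
equal to [1].  Thus [f a = a] and [f b = b], because roots are unique in [G]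
([fixed_noncommuting]).  A nontrivial element of [D] cannot share a power with
both [a] and [b], which do not commute, so its ratio is also [1] and [f] fixes it
([fixes_domain]). *)

(** * Subgroups as groups, and the coset map as a morphism *)

Section SubgroupType.
Variables (G : groupType) (H : set G).

Let mem_subg : pred G := fun x => `[< H x >].

(** The proof that [H] is a subgroup is an argument, so that the group
structure can be inferred from the type. *)
Definition subg (sH : subgroup H) := {x : G | mem_subg x}.

Variable sH : subgroup H.

HB.instance Definition _ := SubChoice.on (subg sH).

Let mem_subg_group_closed : group_closed mem_subg.
Proof.
have [H1 HM HV] := sH; split; first exact/asboolP.
by move=> x y /asboolP Hx /asboolP Hy; apply/asboolP/HM => //; exact: HV.
Qed.

HB.instance Definition _ :=
  SubChoice_isSubGroup.Build G mem_subg (subg sH) mem_subg_group_closed.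

Lemma subgP (u : subg sH) : H (val u).
Proof. exact/asboolP/(valP u). Qed.

Lemma subgM (u v : subg sH) : val (u * v) = val u * val v.
Proof. exact: gmulfM. Qed.

Lemma subgV (u : subg sH) : val u^-1 = (val u)^-1.
Proof. exact: gmulfV. Qed.

Lemma subgX (u : subg sH) n : val (u ^+ n) = val u ^+ n.
Proof. exact: gmulfXn. Qed.

Lemma subgR (u v : subg sH) : val [~ u, v] = [~ val u, val v].
Proof. exact: gmulfR. Qed.

Lemma subg_lift x : H x -> exists u : subg sH, val u = x.
Proof. by move=> /asboolP Hx; exists (Sub x Hx); rewrite SubK. Qed.

End SubgroupType.

Section CosetMorphism.
Variables (G : groupType) (N : normal_subgroup G).

HB.instance Definition _ := isMultiplicative.Build G (quotient_group N)
  (@coset_class G N) (fun x y => esym (coset_mulE N x y)).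
HB.instance Definition _ := Multiplicative_isUMagmaMorphism.Build G
  (quotient_group N) (@coset_class G N) erefl.

Lemma coset_class1P x : coset_class N x = 1 <-> normal_set N x.
Proof.
rewrite -[RHS]/(coset_class N 1); split=> [/esym/coset_eqP/asboolP|Nx].
  by rewrite invg1 mul1g.
by apply/esym/coset_eqP/asboolP; rewrite invg1 mul1g.
Qed.

End CosetMorphism.

(** * Commutators and the upper central series of a torsion-free nilpotent group *)

Lemma commXg_central (G : groupType) (x y : G) n :
  commute x [~ x, y] -> [~ x ^+ n, y] = [~ x, y] ^+ n.
Proof.
move=> cxz; rewrite commgEl conjXg.
have -> : x ^ y = x * [~ x, y] by rewrite commgEl mulVKg.
by rewrite expgMn // mulKg.
Qed.

Lemma commXXg_central (G : groupType) (x y : G) m n :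
  commute x [~ x, y] -> commute y [~ x, y] ->
  [~ x ^+ m, y ^+ n] = [~ x, y] ^+ (m * n).
Proof.
move=> cx cy; have cy' : commute y [~ y, x] by rewrite -invgR; exact: commuteV.
have E : [~ x, y ^+ n] = [~ x, y] ^+ n.
  by rewrite -(invgR (y ^+ n)) commXg_central // -expVgn invgR.
rewrite commXg_central E; last exact: commuteX.
by rewrite mulnC expgnA.
Qed.

Section UpperCentral.
Variable G : groupType.

Fixpoint upper_central (n : nat) : set G :=
  if n is n'.+1 then [set x | forall y, upper_central n' [~ x, y]]
  else [set 1].

Lemma upper_central_normal n : subgroup (upper_central n) /\
  forall x g, upper_central n x -> upper_central n (x ^ g).
Proof.
elim: n => [|n [[U1 UM UV] UJ]].
  split; last by move=> _ g ->; rewrite /= conj1g.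
  split=> //= [_ _ -> ->|_ ->]; [exact: mulg1 | exact: invg1].
have V1 : upper_central n.+1 1 by move=> y; rewrite comm1g.
have VM x y : upper_central n.+1 x -> upper_central n.+1 y ->
    upper_central n.+1 (x * y).
  move=> Ux Uy g.
  have -> : [~ x * y, g] = [~ x, g] ^ y * [~ y, g].
    by rewrite !commgEl conjMg !conjgE !invgM !mulgA !gnorm.
  by apply: UM; [exact/UJ/Ux | exact: Uy].
split; first split=> // x Ux g.
  have -> : [~ x^-1, g] = ([~ x, g] ^ x^-1)^-1.
    by rewrite !commgEl !conjgE !gnorm.
  by apply/UV/UJ/Ux.
move=> x g Ux y.
have -> : [~ x ^ g, y] = [~ x, y ^ g^-1] ^ g by rewrite conjRg conjgKV.
exact/UJ/Ux.
Qed.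

Definition upper_central_subgroup n :=
  NormalSubgroup (upper_central_normal n).1 (upper_central_normal n).2.

Local Notation U := upper_central_subgroup.

Lemma upper_central_sub m n : m <= n -> upper_central m `<=` upper_central n.
Proof.
have step k : upper_central k `<=` upper_central k.+1.
  elim: k => [_ -> y|k IH x Ux y]; first exact: comm1g.
  exact/IH/Ux.
move=> /subnKC <-; elim: (n - m) => [|k IH]; first by rewrite addn0.
by rewrite addnS; apply: subset_trans IH (step _).
Qed.

Lemma upper_central_commute n x y : upper_central n.+1 x ->
  commute (coset_class (U n) x) (coset_class (U n) y).
Proof.
move=> Ux; apply/commgP/eqP; rewrite -gmulfR; exact/coset_class1P/Ux.
Qed.

Hypothesis tfG : torsion_free G.

(** Modulo the [n]-th term, [[~ x ^+ k, y]] is the [k]-th power of [[~ x, y]] for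
[x] in the term [n + 2]; so torsion in one factor of the series would give
torsion in the factor below, and eventually in [G]. *)
Lemma upper_central_factor_tf n x k : 0 < k ->
  upper_central n.+1 x -> upper_central n (x ^+ k) -> upper_central n x.
Proof.
move=> k0; elim: n x => [|n IH] x Ux Uxk; first exact: tfG k0 Uxk.
move=> y; apply: IH; first exact: Ux.
have E : coset_class (U n) [~ x, y] ^+ k = coset_class (U n) [~ x ^+ k, y].
  rewrite [RHS]gmulfR gmulfXn commXg_central; first by rewrite -gmulfR.
  rewrite -gmulfR; apply/commute_sym/upper_central_commute/Ux.
by apply/(coset_class1P (U n)); rewrite gmulfXn E; exact/coset_class1P/Uxk.
Qed.

Variable c : nat.
Hypothesis nilG : upper_central c = setT.

Lemma upper_central_isolated n x k : 0 < k ->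
  upper_central n (x ^+ k) -> upper_central n x.
Proof.
move=> k0 Uxk; have : upper_central (n + c) x.
  by apply: (@upper_central_sub c); [exact: leq_addl | rewrite nilG].
elim: c => [|m IH]; first by rewrite addn0.
rewrite addnS => /(upper_central_factor_tf k0) Ux; apply/IH/Ux.
exact: upper_central_sub (leq_addr _ _) _ Uxk.
Qed.

(** Write [y = x * z].  If [z] lies in the term [m + 1], it is central modulo the
term [m], so that [z ^+ k] is trivial there and [z] lies in the term [m]; hence
[z] descends the series as far as the term [n]. *)
Lemma upper_central_root n (x y : G) k : 0 < k ->
  coset_class (U n) (x ^+ k) = coset_class (U n) (y ^+ k) ->
  coset_class (U n) x = coset_class (U n) y.
Proof.
move=> k0 E; apply/coset_eqP/asboolP; rewrite /=; set z := _ * _.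
have : upper_central (n + c) z.
  by apply: (@upper_central_sub c); [exact: leq_addl | rewrite nilG].
elim: c => [|m IH]; first by rewrite addn0.
rewrite addnS => Uz; apply: IH; apply: (upper_central_factor_tf k0) => //.
apply/(coset_class1P (U (n + m))); rewrite gmulfXn.
have Exy : coset_class (U (n + m)) (x ^+ k) = coset_class (U (n + m)) (y ^+ k).
  apply/coset_eqP/asboolP/(upper_central_sub (leq_addr m n)).
  by move/coset_eqP/asboolP: E.
have Ey : y = x * z by rewrite /z mulVKg.
move: Exy; rewrite {1}Ey !gmulfXn gmulfM expgMn; last first.
  exact/commute_sym/upper_central_commute.
by rewrite -{1}[LHS]mulg1 => /mulgI.
Qed.

(** [x] and [x ^ y] have the same [k]-th power modulo the [n]-th term, so unique
roots apply. *)
Lemma upper_central_centralizer n x y k : 0 < k ->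
  upper_central n [~ x ^+ k, y] -> upper_central n [~ x, y].
Proof.
move=> k0 /(coset_class1P (U n)); rewrite gmulfR => /eqP/conjg_fixP.
rewrite -gmulfJ conjXg => /(upper_central_root k0).
rewrite gmulfJ => E; apply/(coset_class1P (U n)); rewrite gmulfR.
exact/eqP/conjg_fixP.
Qed.

Lemma nilpotent_root (x y : G) k : 0 < k -> x ^+ k = y ^+ k -> x = y.
Proof.
move=> k0 E; have /coset_eqP/asboolP : coset_class (U 0) x = coset_class (U 0) y.
  by apply: (upper_central_root k0); rewrite E.
by move=> /mulg1_eq; rewrite invgK.
Qed.

End UpperCentral.

(** * Homomorphisms to the rationals *)

(** Homomorphisms are total functions with junk values outside the subgroup, so
that those defined on different subgroups have the same type. *)
Definition rat_hom (G : groupType) (F : set G) (p : G -> rat) : Prop :=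
  forall x y, F x -> F y -> p (x * y) = (p x + p y)%R.

Section RatHom.
Variables (G : groupType) (F : set G) (p : G -> rat).
Hypotheses (sF : subgroup F) (hp : rat_hom F p).
Import GRing.Theory.

Lemma rat_hom1 : p 1 = 0%R.
Proof.
have [F1 _ _] := sF; apply: (@addrI _ (p 1)).
by rewrite -hp // mulg1 addr0.
Qed.

Lemma rat_homV x : F x -> p x^-1 = (- p x)%R.
Proof.
move=> Fx; have [_ _ FV] := sF; apply: (@addrI _ (p x)).
by rewrite -hp ?mulgV ?rat_hom1 ?subrr //; exact: FV.
Qed.

Lemma subgroupX x n : F x -> F (x ^+ n).
Proof.
move=> Fx; have [F1 FM _] := sF; elim: n => [|n IH]; first by rewrite expg0.
by rewrite expgS; exact: FM.
Qed.

Lemma rat_homX x n : F x -> p (x ^+ n) = (n%:R * p x)%R.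
Proof.
move=> Fx; elim: n => [|n IH]; first by rewrite expg0 rat_hom1 mul0r.
by rewrite expgS hp ?IH ?mulrS ?mulrDl ?mul1r //; exact: subgroupX.
Qed.

End RatHom.

(** Some positive power of [x] lies in the cyclic subgroup of [y].  An integer
exponent of [y] is represented as a difference of two natural ones. *)
Definition depends_on (G : groupType) (x y : G) : Prop :=
  exists n i j, 0 < n /\ x ^+ n * y ^+ i = y ^+ j.

Section Abelian.
Implicit Types A : groupType.
Import GRing.Theory Num.Theory.

Lemma expg_inj A (x : A) : (forall n, 0 < n -> x ^+ n <> 1) ->
  injective (fun n => x ^+ n).
Proof.
move=> xtf m n; wlog le : m n / m <= n => [W E|E].
  by case: (leqP m n) => [|/ltnW] /W => [->|<-].
have E1 : x ^+ (n - m) = 1 by rewrite expgnFr // -E mulgV.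
by case: (posnP (n - m)) => [|/xtf//]; lia.
Qed.

(** The homomorphism sends [z] to [(j - i) / k] whenever
[z ^+ k * x ^+ i = x ^+ j]; the value does not depend on the equation, as [x] has
infinite order. *)
Lemma rank_one_hom A (x : A) :
  (forall y z : A, commute y z) -> (forall n, 0 < n -> x ^+ n <> 1) ->
  (forall z, depends_on z x) ->
  exists2 p, rat_hom setT p & p x = 1%R.
Proof.
move=> cA /expg_inj xI dA.
have /choice[k /choice[i /choice[j kij]]] := dA.
have E u n a b m c d : 0 < n -> 0 < m -> u ^+ n * x ^+ a = x ^+ b ->
    u ^+ m * x ^+ c = x ^+ d ->
    ((b%:R - a%:R) / n%:R = (d%:R - c%:R) / m%:R :> rat)%R.
  move=> n0 m0 E1 E2.
  have E3 : (b * m + c * n = d * n + a * m)%N.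
    apply: xI; rewrite /= !expgnDr (expgnA x b) (expgnA x d) -E1 -E2.
    by rewrite !expgMn // -!expgnA -!mulgA -!expgnDr [(m * n)%N]mulnC addnC.
  have n1 : (n%:R != 0 :> rat)%R by rewrite pnatr_eq0 -lt0n.
  have m1 : (m%:R != 0 :> rat)%R by rewrite pnatr_eq0 -lt0n.
  have := congr1 (fun w => w%:R%R : rat) E3; rewrite !natrD !natrM => E4.
  apply/eqP; rewrite eqr_div //; apply/eqP; lra.
exists (fun z => ((j z)%:R - (i z)%:R) / (k z)%:R)%R; last first.
  have [k0 Ex] := kij x.
  by rewrite (@E x _ _ _ 1%N 0%N 1%N k0) //= ?expg0 ?mulg1 //.
move=> y z _ _; have [ky Ey] := kij y; have [kz Ez] := kij z.
have [kyz Eyz] := kij (y * z).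
rewrite (@E (y * z) _ _ _ (k y * k z)%N (i y * k z + i z * k y)%N
  (j y * k z + j z * k y)%N kyz _ Eyz); first last.
- rewrite expgMn // !expgnDr expgnA [in z ^+ _]mulnC !expgnA -Ey -Ez.
  rewrite !expgMn // -!mulgA; congr (_ * _).
  by rewrite !mulgA; congr (_ * _); exact: cA.
- by rewrite muln_gt0 ky.
have n1 : ((k y)%:R != 0 :> rat)%R by rewrite pnatr_eq0 -lt0n.
have m1 : ((k z)%:R != 0 :> rat)%R by rewrite pnatr_eq0 -lt0n.
by rewrite !natrD !natrM; field; rewrite n1 m1.
Qed.

(** The subgroup generated by [B] and [y], when [A] is abelian and [B] is a
subgroup. *)
Definition adjoin A (B : set A) (y : A) : set A :=
  [set w | exists i j, B (w * y ^+ i * y ^- j)].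

Lemma adjoin_subgroup A (B : set A) y : (forall y z : A, commute y z) ->
  subgroup B -> subgroup (adjoin B y).
Proof.
move=> cA [B1 BM BV]; split.
- by exists 0%N, 0%N; rewrite !gsimp.
- move=> u v [i [j Bu]] [i' [j' Bv]]; exists (i + i')%N, (j + j')%N.
  have -> : u * v * y ^+ (i + i') * y ^- (j + j') =
      (u * y ^+ i * y ^- j) * (v * y ^+ i' * y ^- j').
    have mulgACA (p q r t : A) : p * q * (r * t) = p * r * (q * t).
      by rewrite !mulgA -[p * q * r]mulgA (cA q r) mulgA.
    by rewrite !expgnDr invgM [u * v * _]mulgACA [y ^- j' * _]cA mulgACA.
  exact: BM.
- move=> u [i [j /BV Bu]]; exists j, i.
  by move: Bu; rewrite !invgM invgK mulgA [_ * u^-1]cA mulgA.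
Qed.

(** Let [B] be maximal among the subgroups that contain no positive power of [x].
By maximality every element has, modulo [B], a positive power in the cyclic
subgroup of [x], so that [A / B] has rank one. *)
Lemma infinite_order_hom A (x : A) :
  (forall y z : A, commute y z) -> (forall n, 0 < n -> x ^+ n <> 1) ->
  exists2 p, rat_hom setT p & p x = 1%R.
Proof.
move=> cA xtf.
(* The empty set is admitted because it is the union of the empty chain. *)
pose P B := B = set0 \/ subgroup B /\ forall n, 0 < n -> ~ B (x ^+ n).
have [B [PB Bmax]] : exists B, P B /\ forall C, B `<` C -> ~ P C.
  apply: Zorn_bigcup => F FP Ftot.
  case: (pselect (exists2 B, F B & B !=set0)) => [[B0 FB0 [b0 Bb0]]|nF]; last first.
    left; apply/seteqP; split=> // z [B FB Bz].
    by apply: nF; exists B => //; exists z.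
  have sF B z : F B -> B z -> subgroup B /\ forall n, 0 < n -> ~ B (x ^+ n).
    by move=> /FP[->|].
  right; split; last by move=> n n0 [B FB Bx]; exact: (sF B _ FB Bx).2 Bx.
  split.
  - by exists B0 => //; have [[]] := sF _ _ FB0 Bb0.
  - move=> u v [B FB Bu] [C FC Cv].
    have [BC|CB] := Ftot _ _ FB FC.
      by exists C => //; have [[_ CM _] _] := sF _ _ FC Cv; exact/CM/Cv/BC.
    by exists B => //; have [[_ BM _] _] := sF _ _ FB Bu; exact/BM/CB.
  - move=> u [B FB Bu]; exists B => //.
    by have [[_ _ BV] _] := sF _ _ FB Bu; exact: BV.
have [sB xB] : subgroup B /\ forall n, 0 < n -> ~ B (x ^+ n).
  case: PB => // B0; case: (Bmax [set 1]).
    by rewrite B0; split=> [? []|] // /(_ 1 erefl).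
  right; split; last exact: xtf.
  by split=> //= [_ _ -> ->|_ ->]; [exact: mulg1 | exact: invg1].
have BJ z g : B z -> B (z ^ g) by move=> Bz; rewrite conjgE cA -mulgA mulgV mulg1.
pose N := NormalSubgroup sB BJ.
have cM (y z : quotient_group N) : commute y z.
  have [u <-] := coset_class_surj y; have [v <-] := coset_class_surj z.
  exact/gmulf_commute/cA.
have [||p hp px] := @rank_one_hom (quotient_group N) (coset_class N x) cM.
- by move=> n n0; rewrite -gmulfXn => /coset_class1P; exact: xB.
- move=> z'; have [z <-] := coset_class_surj z'.
  case: (pselect (B z)) => [Bz|nBz].
    exists 1%N, 0%N, 0%N; split=> //.
    by rewrite !expg0 mulg1 expg1; apply/coset_class1P.
  have [n n0 [i [j]]] : exists2 n, 0 < n & adjoin B z (x ^+ n).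
    apply: contrapT => nx; apply: (Bmax (adjoin B z)); last first.
      right; split; first exact: adjoin_subgroup.
      by move=> n n0 Bx; apply: nx; exists n.
    split=> [u Bu|sub]; first by exists 0%N, 0%N; rewrite !gsimp.
    apply: nBz; apply: sub; exists 0%N, 1%N; rewrite expg0 expg1 mulg1 mulgV.
    by have [] := sB.
  move=> /(coset_class1P N); rewrite gmulfM gmulfV gmulfM !gmulfXn.
  set X := coset_class N x; set Z := coset_class N z => /divg1_eq E.
  case: (ltngtP i j) => [lt|lt|ij].
  + exists (j - i)%N, 0%N, n; split; first by rewrite subn_gt0.
    by rewrite mulg1 expgnFr ?(ltnW lt) // -E mulgK.
  + exists (i - j)%N, n, 0%N; split; first by rewrite subn_gt0.
    by rewrite cM expgnFr ?(ltnW lt) // mulgA E mulgV.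
  + exfalso; apply: (xB n n0); apply/(coset_class1P N); rewrite gmulfXn.
    by apply: (mulIg (Z ^+ i)); rewrite mul1g {2}ij.
exists (p \o coset_class N); last exact: px.
by move=> u v _ _ /=; rewrite gmulfM hp.
Qed.

(** Kill [y] first: [x] keeps infinite order in the quotient by the cyclic subgroup
of [y]. *)
Lemma independent_hom A (x y : A) :
  (forall y z : A, commute y z) -> ~ depends_on x y ->
  exists p, [/\ rat_hom setT p, p x = 1%R & p y = 0%R].
Proof.
move=> cA nd.
have s1 : subgroup [set 1 : A].
  by split=> //= [_ _ -> ->|_ ->]; [exact: mulg1 | exact: invg1].
have sY := adjoin_subgroup y cA s1.
have YJ z g : adjoin [set 1] y z -> adjoin [set 1] y (z ^ g).
  by rewrite conjgE [z * g]cA mulKg.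
pose N := NormalSubgroup sY YJ.
have [|n n0|p hp px] := @infinite_order_hom (quotient_group N) (coset_class N x).
- move=> u' v'.
  have [u <-] := coset_class_surj u'; have [v <-] := coset_class_surj v'.
  exact/gmulf_commute/cA.
- rewrite -gmulfXn => /coset_class1P[i [j /divg1_eq E]].
  by apply: nd; exists n, i, j.
exists (p \o coset_class N); split=> //=.
  by move=> u v _ _ /=; rewrite gmulfM hp.
have -> : coset_class N y = 1.
  by apply/coset_class1P; exists 0%N, 1%N; rewrite /= !gsimp.
exact: (rat_hom1 (@subgroupT _) hp).
Qed.

End Abelian.

Lemma subgroup_generated (G : groupType) (A : set G) : subgroup (generated A).
Proof.
split=> [H [[]]//|x y Fx Fy H HA|x Fx H HA]; have [[H1 HM HV] _] := HA.
- by apply: HM; [exact: (Fx H HA) | exact: (Fy H HA)].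
- exact: HV (Fx H HA).
Qed.

(** * Torsion-free nilpotent groups have enough homomorphisms *)

Section TorsionFreeNilpotent.
Variables (N : groupType) (c : nat).
Hypotheses (tfN : torsion_free N) (nilN : @upper_central N c = setT).
Import GRing.Theory Num.Theory.

Lemma last_proper_upper_central (x : N) : x <> 1 ->
  exists k, @upper_central N k.+1 = setT /\ exists z, ~ @upper_central N k z.
Proof.
move=> x1; have ex : exists n, `[< @upper_central N n = setT >].
  by exists c; exact/asboolP.
case: (ex_minnP ex) => -[/asboolP U0 _|k /asboolP Uk min].
  by case: x1; have : [set: N] x by []; rewrite -U0.
exists k; split=> //; apply: contrapT => nz.
suff /asboolP/min : @upper_central N k = setT by rewrite ltnn.
by apply/seteqP; split=> // z _; apply: contrapT => nUz; apply: nz; exists z.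
Qed.

Lemma quotient_top_commute k : @upper_central N k.+1 = setT ->
  forall a b : quotient_group (@upper_central_subgroup N k), commute a b.
Proof.
move=> Uk a b; have [u <-] := coset_class_surj a.
by have [v <-] := coset_class_surj b; apply: upper_central_commute; rewrite Uk.
Qed.

Lemma nilpotent_hom (x : N) : x <> 1 ->
  exists p : N -> rat, rat_hom setT p /\ exists z, p z <> 0%R.
Proof.
move=> /last_proper_upper_central[k [Uk [z nUz]]].
have [|p hp pz] := infinite_order_hom
    (x := coset_class (@upper_central_subgroup N k) z) (quotient_top_commute Uk).
  move=> n n0; rewrite -gmulfXn => /coset_class1P.
  by move=> /(upper_central_isolated tfN nilN n0).
exists (p \o coset_class _); split; first by move=> u v _ _ /=; rewrite gmulfM hp.
by exists z; rewrite /= pz; apply/eqP/oner_neq0.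
Qed.

(** Let the series reach the whole group at the index [k + 2].  If the quotient by
the term [k + 1] had rank one, any two of its elements would be dependent, hence
[x ^+ n] would commute with [y] modulo the term [k], for some positive [n].
Centralizers are closed under roots, so the group would already be the term
[k + 1]. *)
Lemma nilpotent_rank2 (x y : N) : ~ commute x y ->
  exists (p q : N -> rat) u v, [/\ rat_hom setT p, rat_hom setT q,
    p u = 1%R, p v = 0%R & q u = 0%R /\ q v = 1%R].
Proof.
move=> ncxy; have x1 : x <> 1.
  by move=> x1; apply: ncxy; rewrite x1; apply/commute_sym/commute1.
have [[|k] [Uk [z nUz]]] := last_proper_upper_central x1.
  case: ncxy; have : @upper_central N 1 x by rewrite Uk.
  by move=> /(_ y)/= /eqP/commgP.
have cA := quotient_top_commute Uk.
set U := @upper_central_subgroup N k.+1 in cA.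
suff [u [v [nuv nvu]]] : exists u v, ~ depends_on (coset_class U u) (coset_class U v)
    /\ ~ depends_on (coset_class U v) (coset_class U u).
  have [p [hp pu pv]] := independent_hom cA nuv.
  have [q [hq qv qu]] := independent_hom cA nvu.
  exists (p \o coset_class U), (q \o coset_class U), u, v; split=> //.
    by move=> ? ? _ _ /=; rewrite gmulfM hp.
  by move=> ? ? _ _ /=; rewrite gmulfM hq.
apply: contrapT => rk1; apply: nUz => y'.
have dep u v : depends_on (coset_class U u) (coset_class U v) ->
    @upper_central N k [~ u, v].
  move=> [n [i [j [n0]]]]; rewrite -!gmulfXn -gmulfM => /esym/coset_eqP/asboolP.
  set t := _ * _ => Ut; apply: (upper_central_centralizer tfN nilN n0).
  have -> : u ^+ n = v ^+ j * t * v ^- i by rewrite mulVKg mulgK.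
  clearbody t.
  apply/(coset_class1P (@upper_central_subgroup N k)); rewrite gmulfR.
  apply/eqP/commgP/commute_sym; rewrite !gmulfM gmulfV !gmulfXn.
  apply: commuteM; [apply: commuteM|].
  - exact/commuteX/commute_refl.
  - exact/commute_sym/upper_central_commute.
  - exact/commuteV/commuteX/commute_refl.
have [//|nd] := pselect (@upper_central N k [~ z, y']).
have [[_ _ UV] _] := @upper_central_normal N k.
case: rk1; exists z, y'; split=> /dep // Uyz.
by apply: nd; rewrite -invgR; apply: UV.
Qed.

End TorsionFreeNilpotent.

(** * Finitely generated subgroups of residually locally nilpotent groups *)

Section Residual.
Variable G : groupType.

(** Nilpotency is assumed of a subset [A] of [G / M], in terms of its lower central
series, but used for the quotient of [H], as a group in its own right, in terms
of the upper central series. *)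
Lemma lower_upper_central (H : set G) (sH : subgroup H) (M : normal_subgroup G)
    (N : normal_subgroup (subg sH)) (A : set (quotient_group M)) n i :
  (forall u, normal_set N u <-> normal_set M (val u)) ->
  (forall x, H x -> A (coset_class M x)) ->
  lower_central A n = [set 1] -> i <= n ->
  forall u : subg sH, lower_central A (n - i) (coset_class M (val u)) ->
    @upper_central (quotient_group N) i (coset_class N u).
Proof.
move=> NM HA An; elim: i => [|i IH] le u.
  rewrite subn0 An => /coset_class1P/NM Nu; exact/coset_class1P.
move=> Lu a; have [v <-] := coset_class_surj a; rewrite -gmulfR.
apply: (IH (ltnW le)); rewrite -subnSK //=.
apply: (@sub_gen_smallest _ (@subgroup _)).
exists (coset_class M (val u)); rewrite //=.
exists (coset_class M (val v)); first by apply: HA; exact: (subgP v).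
by rewrite -!gmulfR.
Qed.

Hypothesis Gres : residually_locally_tf_nilpotent G.

(** [N] is the intersection of [M] with the subgroup generated by [s].  The quotient
by [N] is nilpotent, while [G / M] also has room for elements outside that
subgroup, such as the images of its elements under a commensuration. *)
Lemma fg_residual (s : seq G) (F := generated [set` s]) (g : G) : g <> 1 ->
  exists (M : normal_subgroup G) (N : normal_subgroup (subg (subgroup_generated [set` s]))),
  [/\ ~ normal_set M g, torsion_free (quotient_group M),
   (forall u, normal_set N u <-> normal_set M (val u)),
   torsion_free (quotient_group N)
   & exists c, @upper_central (quotient_group N) c = setT].
Proof.
move=> /eqP/Gres[M [nMg tfM nilM]].
have [M1 MM MV] := normal_subgroupP M.
pose S := [set u : subg (subgroup_generated [set` s]) | normal_set M (val u)].
have sS : subgroup S.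
  by split=> [|u v Su Sv|u Su]; rewrite /S /= ?gmulf1 ?gmulfM ?gmulfV; auto.
have SJ u v : S u -> S (u ^ v).
  by move=> Su; rewrite -[S _]/(normal_set M (val (u ^ v))) gmulfJ; apply: normalJ.
exists M, (NormalSubgroup sS SJ); split=> //.
  move=> a n n0; have [u <-] := coset_class_surj a.
  rewrite -gmulfXn => /coset_class1P.
  rewrite -[normal_set _ _]/(normal_set M (val (u ^+ n))) gmulfXn.
  move=> /(coset_class1P M); rewrite gmulfXn => /(tfM _ _ n0)/coset_class1P Mu.
  exact/coset_class1P.
have fA : finite_set (coset_class M @` [set` s]).
  by apply: finite_image; apply/finite_seqP; exists s.
have [n An] := nilM _ fA; exists n; apply/seteqP; split=> // a _.
have [u <-] := coset_class_surj a.
have FA x : F x -> generated (coset_class M @` [set` s]) (coset_class M x).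
  have [B1 BM BV] := subgroup_generated (coset_class M @` [set` s]).
  move: x; apply: smallest_sub.
    split=> [|x y Bx By|x Bx]; first exact: B1.
      by rewrite /preimage /= gmulfM; exact: BM.
    by rewrite /preimage /= gmulfV; exact: BV.
  by move=> x sx; apply: sub_gen_smallest; exists x.
apply: (lower_upper_central (M := M) _ FA An (leqnn n)) => //.
by rewrite subnn; apply: FA; exact: subgP.
Qed.

Lemma residual_root (x y : G) n : 0 < n -> x ^+ n = y ^+ n -> x = y.
Proof.
move=> n0 E; apply: contrapT => xy.
have [|M [N [nM _ NM tfN [c nilN]]]] := @fg_residual [:: x; y] (x^-1 * y).
  by move=> /mulg1_eq; rewrite invgK.
set sF := subgroup_generated _ in N NM tfN nilN.
have [|u ux] := subg_lift sF (x := x).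
  by apply: sub_gen_smallest; rewrite /= inE eqxx.
have [|v vy] := subg_lift sF (x := y).
  by apply: sub_gen_smallest; rewrite /= !inE eqxx orbT.
suff /coset_eqP/asboolP/NM : coset_class N u = coset_class N v.
  by rewrite subgM subgV ux vy.
apply: (nilpotent_root tfN nilN n0); rewrite -!gmulfXn; congr (coset_class N _).
by apply: val_inj; rewrite !subgX ux vy.
Qed.

Lemma residual_torsion_free : torsion_free G.
Proof. by move=> x n n0 E; apply: (residual_root n0); rewrite E expg1n. Qed.

Lemma residual_centralizer (x y : G) n : 0 < n -> commute (x ^+ n) y ->
  commute x y.
Proof.
move=> n0 /commgP/conjg_fixP; rewrite conjXg => /(residual_root n0) E.
exact/commgP/conjg_fixP.
Qed.

Lemma subg_hom (H : set G) (sH : subgroup H) (p : subg sH -> rat) :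
  rat_hom setT p ->
  exists p', rat_hom H p' /\ forall u, p' (val u) = p u.
Proof.
move=> hp; exists (p \o insubd 1); split=> [x y Hx Hy|u] /=; last by rewrite valKd.
have [u <-] := subg_lift sH Hx; have [v <-] := subg_lift sH Hy.
by rewrite -subgM !valKd hp.
Qed.

Section FinitelyGenerated.
Variables (s : seq G).
Local Notation F := (generated [set` s]).
Let sF : subgroup F := subgroup_generated [set` s].

Lemma fg_hom x : F x -> x <> 1 ->
  exists p, rat_hom F p /\ exists2 z, F z & p z <> 0%R.
Proof.
move=> Fx x1; have [M [N [nM _ NM tfN [c nilN]]]] := @fg_residual s x x1.
have [u ux] := subg_lift sF Fx.
have [|p [hp [a pa]]] := @nilpotent_hom _ _ tfN nilN (coset_class N u).
  by move=> /coset_class1P/NM; rewrite ux.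
have [v va] := coset_class_surj a.
have [|p' [hp' E]] := @subg_hom F sF (p \o coset_class N).
  by move=> ? ? _ _ /=; rewrite gmulfM hp.
exists p'; split=> //; exists (val v); first exact: subgP.
by rewrite E /= va.
Qed.

Lemma fg_rank2 x y : F x -> F y -> ~ commute x y ->
  exists p q u v, [/\ rat_hom F p /\ rat_hom F q, F u /\ F v,
    p u = 1%R, p v = 0%R & q u = 0%R /\ q v = 1%R].
Proof.
move=> Fx Fy /commgP/eqP xy.
have [M [N [nM _ NM tfN [c nilN]]]] := @fg_residual s _ xy.
have [u ux] := subg_lift sF Fx; have [v vy] := subg_lift sF Fy.
have [|p [q [a [b [hp hq pa pb [qa qb]]]]]] :=
    @nilpotent_rank2 _ _ tfN nilN (coset_class N u) (coset_class N v).
  move=> /commgP/eqP; rewrite -gmulfR => /coset_class1P/NM.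
  by rewrite subgR ux vy.
have [u' ua] := coset_class_surj a; have [v' vb] := coset_class_surj b.
have [|p' [hp' E]] := @subg_hom F sF (p \o coset_class N).
  by move=> ? ? _ _ /=; rewrite gmulfM hp.
have [|q' [hq' E']] := @subg_hom F sF (q \o coset_class N).
  by move=> ? ? _ _ /=; rewrite gmulfM hq.
exists p', q', (val u'), (val v'); rewrite !E !E' /= ua vb.
by split=> //; split; exact: subgP.
Qed.

End FinitelyGenerated.

(** Abelian subgroups are treated without passing to a nilpotent quotient, where
independent elements might become dependent. *)
Section AbelianSubgroup.
Variables (H : set G) (sH : subgroup H).
Hypothesis cH : forall x y, H x -> H y -> commute x y.

Let cS (u v : subg sH) : commute u v.
Proof. by apply: val_inj; rewrite !subgM; apply: cH; exact: subgP. Qed.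

Lemma abelian_subgroup_hom x : H x -> x <> 1 ->
  exists2 p, rat_hom H p & p x = 1%R.
Proof.
move=> Hx x1; have [u ux] := subg_lift sH Hx.
have [n n0 un|p hp pu] := infinite_order_hom (x := u) cS.
  apply: x1; apply: (residual_torsion_free n0).
  by rewrite -ux -subgX un.
have [p' [hp' E]] := subg_hom hp; exists p' => //.
by rewrite -ux E.
Qed.

Lemma abelian_subgroup_independent_hom x y : H x -> H y -> ~ depends_on x y ->
  exists p, [/\ rat_hom H p, p x = 1%R & p y = 0%R].
Proof.
move=> Hx Hy; have [u <-] := subg_lift sH Hx; have [v <-] := subg_lift sH Hy.
move=> nd; have [|p [hp pu pv]] := independent_hom (x := u) (y := v) cS.
  move=> [n [i [j [n0 E]]]]; apply: nd; exists n, i, j; split=> //.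
  by rewrite -!subgX -subgM E.
by have [p' [hp' E]] := subg_hom hp; exists p'; rewrite !E.
Qed.

End AbelianSubgroup.

End Residual.

Import Order.TTheory GRing.Theory Num.Theory.

Lemma rat_hom_generated0 (G : groupType) (A : set G) p :
  rat_hom (generated A) p -> (forall x, A x -> p x = 0%R) ->
  forall x, generated A x -> p x = 0%R.
Proof.
move=> hp pA; have sF := subgroup_generated A; have [F1 FM FV] := sF.
suff : generated A `<=` generated A `&` [set x | p x = 0%R] by move=> H x /H[].
apply: smallest_sub; last by move=> x Ax; split; [exact: sub_gen_smallest | exact: pA].
split=> [|x y [Fx px] [Fy py]|x [Fx px]].
- by split=> //; exact: rat_hom1 sF hp.
- by split; [exact: FM | rewrite /= hp // px py addr0].
- by split; [exact: FV | rewrite /= (rat_homV sF hp) // px oppr0].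
Qed.

(** Two-dimensional linear algebra.  The determinant of [p], [q] at [g], [h] decides
which case holds: if it is nonzero, Cramer's rule gives the dual homomorphisms;
if it vanishes, some nontrivial combination of [p] and [q] kills both [g] and
[h]. *)
Lemma rat_hom_dual (G : groupType) (F : set G) (p q : G -> rat) u v g h :
  F g -> F h -> F u -> F v -> rat_hom F p -> rat_hom F q ->
  p u = 1%R -> p v = 0%R -> q u = 0%R -> q v = 1%R ->
  (exists r, [/\ rat_hom F r, exists2 z, F z & r z <> 0%R,
     r g = 0%R & r h = 0%R]) \/
  (exists r t, [/\ rat_hom F r /\ rat_hom F t,
     r g = 1%R, r h = 0%R, t g = 0%R & t h = 1%R]).
Proof.
move=> Fg Fh Fu Fv hp hq pu pv qu qv.
pose comb (a b : rat) z := (a * p z + b * q z)%R.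
have hcomb a b : rat_hom F (comb a b).
  by move=> x y Fx Fy; rewrite /comb hp // hq //; ring.
have combN a b : (a != 0)%R || (b != 0)%R -> exists2 z, F z & comb a b z <> 0%R.
  move=> /orP[a0|b0]; [exists u | exists v] => //; rewrite /comb ?pu ?qu ?pv ?qv.
    by rewrite mulr1 mulr0 addr0; exact/eqP.
  by rewrite mulr1 mulr0 add0r; exact/eqP.
set D := (p g * q h - p h * q g)%R.
have [D0|D0] := eqVneq D 0%R; last first.
  right; exists (comb (q h / D) (- p h / D))%R, (comb (- q g / D) (p g / D))%R.
  split; [by split | ..]; rewrite /comb; move: D0; rewrite /D => D0; field; exact: D0.
left; have [/orP ng|/norP[/negPn/eqP pg /negPn/eqP qg]] :=
    boolP ((p g != 0)%R || (q g != 0)%R).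
  exists (comb (q g) (- p g)%R); split=> //; rewrite /comb.
  - by apply: combN; rewrite oppr_eq0 orbC; exact/orP.
  - ring.
  - by move: D0; rewrite /D; lra.
have [/orP nh|/norP[/negPn/eqP ph /negPn/eqP qh]] :=
    boolP ((p h != 0)%R || (q h != 0)%R).
  exists (comb (q h) (- p h)%R); split=> //; rewrite /comb.
  - by apply: combN; rewrite oppr_eq0 orbC; exact/orP.
  - by rewrite pg qg; ring.
  - ring.
exists p; split=> //; exists u => //; rewrite pu; exact/eqP/oner_neq0.
Qed.

Lemma depends_on_sym (G : groupType) (x y : G) : torsion_free G ->
  x <> 1 -> depends_on x y -> depends_on y x.
Proof.
move=> tfG x1 [n [i [j [n0 E]]]].
case: (ltngtP i j) => [lt|lt|ij].
- exists (j - i)%N, 0%N, n; split; first by rewrite subn_gt0.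
  by rewrite mulg1 expgnFr ?(ltnW lt) // -E mulgK.
- exists (i - j)%N, n, 0%N; split; first by rewrite subn_gt0.
  have Ex : x ^+ n = y ^+ j / y ^+ i by rewrite -E mulgK.
  by rewrite Ex expgnFr ?(ltnW lt) // !gnorm.
- case: x1; apply: tfG n0 _; apply: (mulIg (y ^+ i)); by rewrite mul1g {2}ij.
Qed.

Section Residual.
Variable G : groupType.
Hypothesis Gres : residually_locally_tf_nilpotent G.

Let tfG : torsion_free G := residual_torsion_free Gres.

(** A positive power of [x] commutes with [y], and centralizers are closed under
roots. *)
Lemma depends_on_commute (x y : G) : depends_on x y -> commute x y.
Proof.
move=> [n [i [j [n0 E]]]]; apply: (residual_centralizer Gres n0).
have -> : x ^+ n = y ^+ j / y ^+ i by rewrite -E mulgK.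
apply/commute_sym/commuteM; first exact/commuteX/commute_refl.
exact/commuteV/commuteX/commute_refl.
Qed.

(** When [F] is not abelian, it has two independent homomorphisms, which give one of
the first two cases; when it is, the dependence of [g] on [h] chooses between the
last two. *)
Lemma fg_pair (s : seq G) g h (F := generated [set` s]) :
  F g -> F h -> g <> 1 -> h <> 1 ->
  [\/ exists r, [/\ rat_hom F r, exists2 z, F z & r z <> 0%R,
     r g = 0%R & r h = 0%R],
   exists r t, [/\ rat_hom F r /\ rat_hom F t,
     r g = 1%R, r h = 0%R, t g = 0%R & t h = 1%R]
   | depends_on g h /\ exists2 r, rat_hom F r & r g = 1%R].
Proof.
move=> Fg Fh g1 h1; have sF := subgroup_generated [set` s].
case: (pselect (exists x y, [/\ F x, F y & ~ commute x y])).
  move=> [x [y [Fx Fy nxy]]].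
  have [p [q [u [v [[hp hq] [Fu Fv] pu pv [qu qv]]]]]] := fg_rank2 Gres Fx Fy nxy.
  have [|] := rat_hom_dual Fg Fh Fu Fv hp hq pu pv qu qv.
    exact: Or31.
  exact: Or32.
move=> nn; have cF x y : F x -> F y -> commute x y.
  by move=> Fx Fy; apply: contrapT => nxy; apply: nn; exists x, y.
have [d|nd] := pselect (depends_on g h).
  by apply: Or33; split=> //; exact: (abelian_subgroup_hom Gres sF cF Fg g1).
have [r [hr rg rh]] := abelian_subgroup_independent_hom sF cF Fg Fh nd.
have [d|nd'] := pselect (depends_on h g).
  by case: nd; exact: depends_on_sym d.
have [t [ht th tg]] := abelian_subgroup_independent_hom sF cF Fh Fg nd'.
by apply: Or32; exists r, t.
Qed.

(** * Left orders with two prescribed signs *)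

(** A left order is determined by its set of positive elements: a subsemigroup that
omits [1] and contains [x] or its inverse for every other [x].  The finite
approximations decide only the elements of a finite list. *)
Definition proper_semigroup (P : set G) : Prop :=
  (forall x y, P x -> P y -> P (x * y)) /\ ~ P 1.

Definition decides (P : set G) (x : G) : Prop := [\/ x = 1, P x | P x^-1].

(** The lexicographic combination of the sign of [p] with a choice of signs on the
kernel of [p]. *)
Lemma lex_semigroup (F : set G) (p : G -> rat) (P : set G) : subgroup F ->
  rat_hom F p -> proper_semigroup P ->
  proper_semigroup [set x | F x /\ ((0 < p x)%R \/ (p x = 0%R /\ P x))].
Proof.
move=> sF hp [PM P1]; have [F1 FM _] := sF; split; last first.
  by move=> [_]; rewrite (rat_hom1 sF hp) ltxx => -[|[]].
move=> x y [Fx Px] [Fy Py]; split; first exact: FM.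
rewrite hp //; case: Px => [px|[px Px]]; case: Py => [py|[py Py]]; [left|left|left|right].
- lra.
- lra.
- lra.
- by rewrite px py addr0; split=> //; exact: PM.
Qed.

Lemma lex_decides (F : set G) (p : G -> rat) (P : set G) x : subgroup F ->
  rat_hom F p -> F x -> (p x = 0%R -> decides P x) ->
  decides [set x | F x /\ ((0 < p x)%R \/ (p x = 0%R /\ P x))] x.
Proof.
move=> sF hp Fx Dx; have [_ _ FV] := sF.
have FVx := FV _ Fx; have pV := rat_homV sF hp Fx.
case: (ltgtP (p x) 0%R) => px.
- by apply: Or33; split=> //; left; rewrite pV; lra.
- by apply: Or32; split=> //; left.
- case: (Dx px) => [->|Px|Px]; first exact: Or31.
    by apply: Or32; split=> //; right.
  by apply: Or33; split=> //; right; rewrite pV px oppr0.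
Qed.

Lemma rat_hom_generator (s : seq G) (p : G -> rat) z :
  rat_hom (generated [set` s]) p -> generated [set` s] z -> p z <> 0%R ->
  exists2 y, y \in s & p y != 0%R.
Proof.
move=> hp Fz pz; apply: contrapT => ny; apply: pz.
apply: (rat_hom_generated0 hp) Fz => y sy; apply/eqP; apply: contrapT => py.
by apply: ny; exists y => //; exact/negP.
Qed.

Lemma size_kernel (s : seq G) (p : G -> rat) y : y \in s -> p y != 0%R ->
  size [seq x <- s | p x == 0%R] < size s.
Proof.
move=> sy py; rewrite size_filter ltn_neqAle count_size andbT -all_count.
by apply: contra py => /allP/(_ _ sy).
Qed.

(** The Burns-Hale argument, by induction on the number of elements: a nonzero
homomorphism is nonzero at one of the generators, so its kernel contains fewer
of them. *)
Lemma finite_signs (s : seq G) :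
  exists2 P, proper_semigroup P & forall x, x \in s -> decides P x.
Proof.
have [n] := ubnP (size s); elim: n s => // n IH s /ltnSE le.
case: (pselect (exists2 x, x \in s & x <> 1)) => [[x sx x1]|n1]; last first.
  exists set0; first by split.
  move=> x sx; apply: Or31; apply: contrapT => x1; apply: n1; by exists x.
pose F := generated [set` s]; have sF : subgroup F := subgroup_generated _.
have sub y : y \in s -> F y by move=> sy; exact: sub_gen_smallest.
have [p [hp [z Fz pz]]] := fg_hom Gres (sub _ sx) x1.
have [y sy py] := rat_hom_generator hp Fz pz.
have [|P sgP dP] := IH [seq x <- s | p x == 0%R].
  exact: leq_trans (size_kernel sy py) le.
eexists; first exact: (lex_semigroup sF hp sgP).
move=> w sw; apply: lex_decides => //; first exact: sub.
by move=> pw; apply: dP; rewrite mem_filter sw pw eqxx.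
Qed.

(** The induction of [finite_signs], as long as some nonzero homomorphism kills both
[g] and [h].  Otherwise a homomorphism separates the signs of [g] and [h] at
once, and the elements of its kernel are unconstrained. *)
Lemma finite_signs_prescribed (g h : G) (s : seq G) : g <> 1 -> h <> 1 ->
  (forall m n, 0 < m -> 0 < n -> g ^+ m <> h ^+ n) ->
  exists P, [/\ proper_semigroup P, P g, P h^-1 &
    forall x, x \in s -> decides P x].
Proof.
move=> g1 h1 ngh.
have [n] := ubnP (size s); elim: n s => // n IH s /ltnSE le.
pose F := generated [set` [:: g, h & s]].
have sF : subgroup F := subgroup_generated _; have [_ _ FV] := sF.
have sub y : y \in [:: g, h & s] -> F y by move=> sy; exact: sub_gen_smallest.
have Fg : F g by apply: sub; rewrite !inE eqxx.
have Fh : F h by apply: sub; rewrite !inE eqxx orbT.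
have Fs x : x \in s -> F x by move=> sx; apply: sub; rewrite !inE sx !orbT.
have split_case r : rat_hom F r -> (0 < r g)%R -> (r h < 0)%R ->
  exists P, [/\ proper_semigroup P, P g, P h^-1 &
    forall x, x \in s -> decides P x].
  move=> hr rg rh; have [P sgP dP] := finite_signs s.
  eexists; split; first exact: (lex_semigroup sF hr sgP).
  - by split=> //; left.
  - by split; [exact: FV | left; rewrite (rat_homV sF hr) //; lra].
  - by move=> x sx; apply: lex_decides => //; [exact: Fs | move=> _; exact: dP].
have [[r [hr [z Fz rz] rg rh]]|[r [t [[hr ht] rg rh tg th]]]|[dgh [r hr rg]]] :=
    fg_pair Fg Fh g1 h1.
- have [y sy ry] := rat_hom_generator hr Fz rz.
  have {}sy : y \in s.
    by move: sy ry; rewrite !inE => /or3P[/eqP->|/eqP->|//]; rewrite ?rg ?rh eqxx.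
  have [|P [sgP Pg Ph dP]] := IH [seq x <- s | r x == 0%R].
    exact: leq_trans (size_kernel sy ry) le.
  eexists; split; first exact: (lex_semigroup sF hr sgP).
  + by split=> //; right.
  + by split; [exact: FV | right; rewrite (rat_homV sF hr) // rh oppr0].
  + move=> x sx; apply: lex_decides => //; first exact: Fs.
    by move=> rx; apply: dP; rewrite mem_filter sx rx eqxx.
- apply: (split_case (fun x => r x - t x)%R).
  + by move=> x y Fx Fy; rewrite hr // ht //; ring.
  + by rewrite rg tg; lra.
  + by rewrite rh th; lra.
(* A relation between g and h, not being one between positive powers, makes
   r h negative. *)
- apply: (split_case r) => //; first by rewrite rg.
  have [m [i [j [m0 E]]]] := dgh.
  have Fgm := subgroupX sF m Fg; have Fhi := subgroupX sF i Fh.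
  have := congr1 r E; rewrite hr // !(rat_homX sF hr) // rg.
  case: (ltngtP i j) => [lt|lt|ij] E1.
  + exfalso; apply: (ngh m (j - i)%N) => //; first by rewrite subn_gt0.
    by rewrite expgnFr ?(ltnW lt) // -E mulgK.
  + have i0 : (0 < (i%:R - j%:R) :> rat)%R by rewrite subr_gt0 ltr_nat.
    have m1 : (0 < m%:R :> rat)%R by rewrite ltr0n.
    rewrite ltNge; apply/negP => rh.
    have := mulr_ge0 (ltW i0) rh; lra.
  + have m1 : (0 < m%:R :> rat)%R by rewrite ltr0n.
    by move: E1; rewrite ij; lra.
Qed.

(** Compactness: an ultrafilter on finite lists, containing for every list the set
of its extensions, turns the semigroups of [finite_signs_prescribed] into one
that decides every element. *)
Lemma left_order_prescribed (g h : G) : g <> 1 -> h <> 1 ->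
  (forall m n, 0 < m -> 0 < n -> g ^+ m <> h ^+ n) ->
  exists lt, [/\ left_order setT lt, lt 1 g & lt h 1].
Proof.
move=> g1 h1 ngh.
have /choice[P PP] := fun s => finite_signs_prescribed s g1 h1 ngh.
pose above (s : seq G) := [set t : seq G | {subset s <= t}].
have FF : ProperFilter (filter_from [set: seq G] above).
  apply: filter_from_proper.
    apply: filter_from_filter; first by exists [::].
    move=> s t _ _; exists (s ++ t) => // u su.
    by split=> x xs; apply: su; rewrite mem_cat xs ?orbT.
  by move=> s _; exists s.
have [U [UU FU]] := ultraFilterLemma FF.
have UF : Filter U by exact: filter_filter.
have Uall (Q : set (seq G)) : (forall s, Q s) -> U Q.
  by move=> allQ; apply: filterS filterT => s _; exact: allQ.
pose pos x := U [set s | P s x].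
have posM x y : pos x -> pos y -> pos (x * y).
  move=> px py; apply: filterS (filterI px py) => s [Px Py].
  by have [[PM _] _ _ _] := PP s; exact: PM.
have pos1 : ~ pos 1.
  move=> p1; apply: (@filter_not_empty _ U).
  by apply: filterS p1 => s; have [[]] := PP s.
exists (fun x y => pos (x^-1 * y)); split; last 2 first.
- by rewrite invg1 mul1g; apply: Uall => s; have [] := PP s.
- by rewrite mulg1; apply: Uall => s; have [] := PP s.
split.
- by move=> x _; rewrite mulVg.
- by move=> x y z _ _ _ /posM pxy /pxy; rewrite -mulgA mulVKg.
- move=> x y _ _ xy; set d := x^-1 * y.
  have Ed : y^-1 * x = d^-1 by rewrite invgM invgK.
  rewrite Ed; have [pd|nd] := in_ultra_setVsetC [set s | P s d] UU; [by left | right].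
  have Ud : U (above [:: d]) by apply: FU; exists [:: d].
  apply: filterS (filterI nd Ud) => s [/= ndP ds].
  have [_ _ _ dP] := PP s.
  have /dP[d1|//|//] : d \in s by apply: ds; rewrite inE.
  by case: xy; move: d1 => /mulg1_eq; rewrite invgK.
- by move=> a x y _ _ _; rewrite invgM -mulgA mulKg.
Qed.

End Residual.

(** * Commensurations acting trivially on virtual orders *)

(** The pigeonhole principle applied to the cosets of the powers of [x]. *)
Lemma finite_index_power (G : groupType) (K : set G) (x : G) :
  finite_index K setT -> exists2 k, 0 < k & K (x ^+ k).
Proof.
move=> /finite_indexTP[[K1 KM KV] [s Hs]].
have /choice[t Ht] : forall n, exists t, t \in s /\ K (t^-1 * x ^+ n).
  by move=> n; have [t ts Kt] := Hs (x ^+ n); exists t.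
have /(uniqPn 1)[i [j [ij]]] : ~~ uniq [seq t n | n <- iota 0 (size s).+1].
  apply/negP => /uniq_leq_size le.
  have : size [seq t n | n <- iota 0 (size s).+1] <= size s.
    by apply: le => _ /mapP[n _ ->]; exact: (Ht n).1.
  by rewrite size_map size_iota ltnn.
rewrite size_map size_iota => js.
have is_ := ltn_trans ij js.
rewrite !(nth_map 0%N) ?size_iota // !nth_iota // !add0n => E.
exists (j - i)%N; first by rewrite subn_gt0.
have := KM _ _ (KV _ (Ht i).2) (Ht j).2.
rewrite E invgM invgK -mulgA mulVKg => KX.
suff -> : x ^+ (j - i) = x ^- i * x ^+ j by [].
by rewrite -{2}(subnKC (ltnW ij)) expgnDr mulKg.
Qed.

Section CentralCommutator.
Variables (N : groupType) (c : nat).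
Hypothesis nilN : @upper_central N c = setT.

(** Take [a] in the lowest term of the series that is not contained in the
center: then [[~ a, b]] lies in the term below. *)
Lemma central_commutator (x y : N) : ~ commute x y ->
  exists a b : N, [~ a, b] <> 1 /\ forall w, commute [~ a, b] w.
Proof.
move=> ncxy; have ex : exists j, `[< exists a, @upper_central N j a /\
    ~ @upper_central N 1 a >].
  exists c; apply/asboolP; exists x; rewrite nilN; split=> // /(_ y)/eqP/commgP.
  exact: ncxy.
case: (ex_minnP ex) => -[|j] /asboolP[a [Ua nUa]] min.
  by case: nUa => w; rewrite Ua comm1g.
have [b nab] : exists b, [~ a, b] <> 1.
  by apply: contrapT => nb; apply: nUa => b; apply: contrapT => nab; apply: nb; exists b.
exists a, b; split=> // w; apply/commgP/eqP; move: w.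
rewrite -[forall w, _]/(@upper_central N 1 [~ a, b]).
apply: contrapT => nU; suff /asboolP/min : exists a, @upper_central N j a /\
    ~ @upper_central N 1 a by rewrite ltnn.
by exists [~ a, b].
Qed.

End CentralCommutator.

Section Main.
Variable G : groupType.
Hypothesis Gres : residually_locally_tf_nilpotent G.
Variable f : commensuration G.
Local Notation D := (cdom f).

Let tfG : torsion_free G := residual_torsion_free Gres.
Let sD : subgroup D := finite_index_subgroup (cdom_fi f).

Lemma cmapX x n : D x -> f (x ^+ n) = f x ^+ n.
Proof.
move=> Dx; elim: n => [|n IH]; first by rewrite !expg0 cmap1.
by rewrite !expgS cmapM ?IH //; exact: subgroupX.
Qed.

(** If a left order had [x] positive and [f x] negative, a power of [f x] in the
subgroup where the order and its image agree would be negative for the order but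
positive for its image. *)
Lemma trivial_action_comparable : (forall u, vlo_agree (push u f) u) ->
  forall x, D x -> exists m n, [/\ 0 < m, 0 < n & f x ^+ m = x ^+ n].
Proof.
move=> triv x Dx; have [D1 _ _] := sD.
have [->|/eqP x1] := eqVneq x 1.
  by exists 1%N, 1%N; rewrite cmap1.
have fx1 : f x <> 1 by rewrite -(cmap1 f) => /(cmap_inj Dx D1).
apply: contrapT => nc.
have [|lt [lo lt1x ltx1]] := left_order_prescribed Gres x1 fx1.
  by move=> m n m0 n0 E; apply: nc; exists n, m.
have ltX (y z : G) : lt y z -> lt 1 (y^-1 * z).
  by move=> /(lo_mul lo (g := y^-1) I I I); rewrite mulVg.
have posX y k : lt 1 y -> 0 < k -> lt 1 (y ^+ k).
  move=> y0; case: k => // k _; elim: k => [|k IH]; first by rewrite expg1.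
  rewrite expgS; apply: (lo_trans lo) (y0) _ => //.
  by have := lo_mul lo (g := y) I I I IH; rewrite mulg1.
have [K [fK Ksub E]] := triv (VirtualOrder (finite_indexTT G) lo).
have [k k0 Kk] := finite_index_power (f x) fK.
have Dxk : D (x ^+ k) by exact: subgroupX.
have K1 : K 1 by case: (finite_index_subgroup fK).
have /= := E _ _ K1 Kk; rewrite -cmapX // -{1}(cmap1 f) => [[E1 _]].
have {E1} : lt 1 (f (x ^+ k)).
  by apply: E1; exists 1, (x ^+ k); split=> //; exact: posX.
rewrite cmapX // => pos.
have neg : lt 1 ((f x)^-1 ^+ k).
  by apply: posX => //; have := ltX _ _ ltx1; rewrite mulg1.
have := lo_mul lo (g := (f x) ^+ k) I I I neg.
rewrite mulg1 expVgn mulgV => /(lo_trans lo I I I pos).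
exact: (lo_irr lo).
Qed.

Hypothesis comparable : forall x, D x ->
  exists m n, [/\ 0 < m, 0 < n & f x ^+ m = x ^+ n].

(** Equality of the ratios [n / m] and [q / p], by homomorphisms on the subgroup
generated by [x], [y] and their images.  One that kills [x] and [y] kills
the images as well, hence is zero; so there are homomorphisms dual to [x] and
[y], to be evaluated at [f (x * y)]. *)
Lemma ratio_eq x y m n p q : D x -> D y -> x <> 1 -> y <> 1 ->
  ~ depends_on x y -> 0 < m -> 0 < p ->
  f x ^+ m = x ^+ n -> f y ^+ p = y ^+ q -> (n * p = q * m)%N.
Proof.
move=> Dx Dy x1 y1 nd m0 p0 Ex Ey.
pose s := [:: x; y; f x; f y]; pose F := generated [set` s].
have sF : subgroup F := subgroup_generated _.
have sub z : z \in s -> F z by move=> sz; exact: sub_gen_smallest.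
have [Fx Fy] : F x /\ F y by split; apply: sub; rewrite !inE eqxx ?orbT.
have [Ffx Ffy] : F (f x) /\ F (f y) by split; apply: sub; rewrite !inE eqxx ?orbT.
have eval r z i j : rat_hom F r -> F z -> F (f z) -> f z ^+ i = z ^+ j ->
    (i%:R * r (f z) = j%:R * r z)%R.
  by move=> hr Fz Ffz /(congr1 r); rewrite !(rat_homX sF hr).
have nz k : 0 < k -> (k%:R != 0 :> rat)%R by rewrite pnatr_eq0 -lt0n.
have [[r [hr [z Fz rz] rx ry]]|[r [t [[hr ht] rx ry tx ty]]]|[]//] :=
    fg_pair Gres Fx Fy x1 y1.
  case: rz; apply: (rat_hom_generated0 hr) Fz => w /=.
  have rfx : r (f x) = 0%R.
    have /eqP := eval _ _ _ _ hr Fx Ffx Ex.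
    by rewrite rx mulr0 mulf_eq0 (negbTE (nz _ m0)) => /eqP.
  have rfy : r (f y) = 0%R.
    have /eqP := eval _ _ _ _ hr Fy Ffy Ey.
    by rewrite ry mulr0 mulf_eq0 (negbTE (nz _ p0)) => /eqP.
  by rewrite !inE => /or4P[]/eqP->.
have [_ DM _] := sD; have [_ FM _] := sF.
have [k [l [k0 l0 Exy]]] := comparable (DM _ _ Dx Dy).
have Fxy : F (x * y) by exact: FM.
have Ffxy : F (f (x * y)) by rewrite cmapM //; exact: FM.
have := eval _ _ _ _ hr Fxy Ffxy Exy; have := eval _ _ _ _ ht Fxy Ffxy Exy.
rewrite cmapM // !hr // !ht //.
have := eval _ _ _ _ hr Fx Ffx Ex; have := eval _ _ _ _ ht Fx Ffx Ex.
have := eval _ _ _ _ hr Fy Ffy Ey; have := eval _ _ _ _ ht Fy Ffy Ey.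
rewrite rx ry tx ty addr0 add0r !mulr0 !mulr1.
move: (r (f x)) (r (f y)) (t (f x)) (t (f y)) => rfx rfy tfx tfy.
move=> E1 /eqP; rewrite mulf_eq0 (negbTE (nz _ p0)) => /eqP rfy0.
move=> /eqP; rewrite mulf_eq0 (negbTE (nz _ m0)) => /eqP tfx0 E2.
rewrite rfy0 tfx0 addr0 !add0r => E3 E4.
have /(mulfI (nz _ k0)) E5 : (k%:R * tfy = k%:R * rfx)%R by rewrite E3 E4.
apply/eqP; rewrite -(eqr_nat rat) !natrM -E1 -E2 E5; apply/eqP; ring.
Qed.

Hypothesis Gnab : nonabelian G.

(** Choose [M] such that the images of [A], [B] in [G / M] have a nontrivial
commutator [C], central in the image of the subgroup they come from.  Since [f]
multiplies exponents by a ratio, it maps [M] into [M], so the images of [f A]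
and [f B] commute with their commutator as well, and the ratio of [C] is the
product of those of [A] and [B]. *)
Lemma fixed_noncommuting :
  exists a b, [/\ D a, D b, ~ commute a b, f a = a & f b = b].
Proof.
have [x [y [Dx Dy ncxy]]] : exists x y, [/\ D x, D y & ~ commute x y].
  apply: contrapT => nn; apply: Gnab => x y.
  have [k k0 Dk] := finite_index_power x (cdom_fi f).
  have [l l0 Dl] := finite_index_power y (cdom_fi f).
  apply: (residual_centralizer Gres k0); apply: commute_sym.
  apply: (residual_centralizer Gres l0); apply: commute_sym.
  by apply: contrapT => nc; apply: nn; exists (x ^+ k), (y ^+ l).
have := ncxy => /commgP/eqP xy1.
have [M [N [nM tfM NM tfN [c nilN]]]] := @fg_residual _ Gres [:: x; y] _ xy1.
have FD : generated [set` [:: x; y]] `<=` D.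
  by apply: smallest_sub => // z; rewrite /= !inE => /orP[]/eqP->.
set sF := subgroup_generated _ in N NM tfN nilN.
have [|u ux] := subg_lift sF (x := x).
  by apply: sub_gen_smallest; rewrite /= inE eqxx.
have [|v vy] := subg_lift sF (x := y).
  by apply: sub_gen_smallest; rewrite /= !inE eqxx orbT.
have [|a' [b' [nab cab]]] :=
    @central_commutator _ _ nilN (coset_class N u) (coset_class N v).
  by move=> /commgP/eqP; rewrite -gmulfR => /coset_class1P/NM; rewrite subgR ux vy.
have [a aa'] := coset_class_surj a'; have [b bb'] := coset_class_surj b'.
rewrite -{}aa' -{}bb' {a' b'} in nab cab.
pose A := val a; pose B := val b; pose C := [~ A, B].
have DA : D A by exact: (FD _ (subgP a)).
have DB : D B by exact: (FD _ (subgP b)).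
have EC : C = val [~ a, b] by rewrite subgR.
have DC : D C by rewrite EC; exact: (FD _ (subgP _)).
have nMC : ~ normal_set M C.
  by rewrite EC => /NM/coset_class1P; rewrite gmulfR => /nab.
have MCw (w : subg sF) : normal_set M [~ C, val w].
  rewrite EC -subgR; apply/NM/coset_class1P; rewrite gmulfR; apply/eqP/commgP.
  by rewrite gmulfR; exact: cab.
have C1 : C <> 1 by move=> C1; apply: nMC; rewrite C1; case: (normal_subgroupP M).
have ncAB : ~ commute A B by move=> /commgP/eqP.
have A1 : A <> 1 by move=> A1; apply: C1; rewrite /C A1 comm1g.
have B1 : B <> 1 by move=> B1; apply: C1; rewrite /C B1 commg1.
have [m [n [m0 n0 EA]]] := comparable DA.
have [p [q [p0 q0 EB]]] := comparable DB.
have [k [l [k0 l0 EfC]]] := comparable DC.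
have nDAB : ~ depends_on A B by move=> /(depends_on_commute Gres).
have nDCA : ~ depends_on C A.
  move=> /(depends_on_sym tfG C1)[i [j [j' [i0 E]]]]; apply: nab.
  have E' : a ^+ i * [~ a, b] ^+ j = [~ a, b] ^+ j'.
    by apply: val_inj; rewrite subgM !subgX -EC.
  apply/eqP/commgP; have := congr1 (coset_class N) E'.
  rewrite gmulfM !gmulfXn !gmulfR => E1.
  have {}E1 : coset_class N a ^+ i = [~ coset_class N a, coset_class N b] ^+ j' /
      [~ coset_class N a, coset_class N b] ^+ j by rewrite -E1 mulgK.
  have : commute (coset_class N a ^+ i) (coset_class N b).
    rewrite E1; apply/commute_sym/commuteM; last apply: commuteV.
      exact/commuteX/commute_sym/cab.
    exact/commuteX/commute_sym/cab.
  move=> /commgP/conjg_fixP; rewrite conjXg => /(nilpotent_root tfN nilN i0) E2.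
  exact/commgP/conjg_fixP.
have R1 := ratio_eq DA DB A1 B1 nDAB m0 p0 EA EB.
have R2 := ratio_eq DC DA C1 A1 nDCA k0 m0 EfC EA.
pose cl := coset_class M.
have clX z i : cl (z ^+ i) = cl z ^+ i by exact: gmulfXn.
have clR z w : cl [~ z, w] = [~ cl z, cl w] by exact: gmulfR.
have [D1 DM DV] := sD.
have fR z w : D z -> D w -> f [~ z, w] = [~ f z, f w].
  move=> Dz Dw; rewrite !commgEl !conjgE !cmapM ?cmapV //; auto.
have fC := fR _ _ DA DB.
have fM w : D w -> normal_set M w -> cl (f w) = 1.
  move=> Dw /(coset_class1P M); rewrite -/(cl w) => Mw; have [i [j [i0 j0 E]]] := comparable Dw.
  by apply: tfM i0 _; rewrite -clX E clX -/cl Mw expg1n.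
have cfC (w : subg sF) : D (val w) -> commute (cl (f (val w))) [~ cl (f A), cl (f B)].
  move=> Dw; apply/commute_sym/commgP/eqP.
  rewrite -clR -fC -clR -fR //.
  apply: fM => //; rewrite !commgEl !conjgE; auto 10.
(* In terms of ratios, R1 says r A = r B, R2 says r C = r A, and R3 says
   r C = r A * r B. *)
have R3 : (l * (m * p) = n * q * k)%N.
  have ntC : forall i, 0 < i -> cl C ^+ i <> 1.
    by move=> i i0 /(tfM _ _ i0)/coset_class1P.
  apply: (expg_inj ntC) => /=.
  have cC (w : subg sF) : commute (cl (val w)) [~ cl A, cl B].
    apply/commute_sym/commgP/eqP; rewrite -clR -clR.
    exact/coset_class1P/MCw.
  have E1 : [~ cl A ^+ n, cl B ^+ q] = cl (f C) ^+ (m * p).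
    by rewrite -!clX -EA -EB !clX commXXg_central ?fC ?clR //; exact: cfC.
  move: E1; rewrite (commXXg_central _ _ (cC a) (cC b)) -clR => E1.
  by rewrite (expgnA _ l) -clX -EfC clX expgnAC -E1 -expgnA.
have Epq : p = q.
  have : (n * k * p = n * k * q)%N by rewrite -{1}R2 -mulnA R3 mulnAC.
  by move=> /eqP; rewrite eqn_pmul2l ?muln_gt0 ?n0 // => /eqP.
have Emn : m = n by move/eqP: R1; rewrite Epq mulnC eqn_pmul2l // => /eqP.
exists A, B; split=> //.
  by apply: (residual_root Gres n0); rewrite -EA Emn.
by apply: (residual_root Gres q0); rewrite -EB Epq.
Qed.

Lemma fixes_domain z : D z -> f z = z.
Proof.
move=> Dz; have [a [b [Da Db nab fa fb]]] := fixed_noncommuting.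
have [->|/eqP z1] := eqVneq z 1; first exact: cmap1.
have a1 : a <> 1 by move=> a1; apply: nab; rewrite a1; exact/commute_sym/commute1.
have b1 : b <> 1 by move=> b1; apply: nab; rewrite b1; exact: commute1.
have indep w : D w -> w <> 1 -> f w = w -> ~ depends_on z w -> f z = z.
  move=> Dw w1 fw nd; have [m [n [m0 n0 E]]] := comparable Dz.
  have : (n * 1 = 1 * m)%N.
    by apply: (ratio_eq Dz Dw z1 w1 nd m0 _ E) => //; rewrite fw.
  by rewrite muln1 mul1n => Emn; apply: (residual_root Gres m0); rewrite E Emn.
have [dza|] := pselect (depends_on z a); last exact: indep.
have [dzb|] := pselect (depends_on z b); last exact: indep.
have czb := depends_on_commute Gres dzb.
have [n [i [j [n0 E]]]] := depends_on_sym tfG z1 dza.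
case: nab; apply: (residual_centralizer Gres n0).
have -> : a ^+ n = z ^+ j / z ^+ i by rewrite -E mulgK.
apply/commute_sym/commuteM; first exact/commuteX/commute_sym.
exact/commuteV/commuteX/commute_sym.
Qed.

End Main.

Theorem corollary1p9 (G : groupType) (Gnab : nonabelian G)
    (Gres : residually_locally_tf_nilpotent G) :
  faithful_action (@vlo_act G).
Proof.
move=> a triv; have [f Ef] := comm_class_surj a; rewrite -{}Ef in triv *.
have agree u : vlo_agree (push u f) u.
  by apply/vlo_classP; rewrite -vlo_actE triv.
have cmp := trivial_action_comparable Gres agree.
apply/comm_classP/comm_agreeP; exists (cdom f); split=> //; first exact: cdom_fi.
by move=> x Dx; exact: (fixes_domain Gres cmp Gnab Dx).
Qed.
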